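(* Let $S,T$ be weakly anticommuting operators in the Hilbert-$B$-module $E$. Then $S^2+T^2$ is self-adjoint and regular on $\mathcal D(S^2)\cap\mathcal D(T^2)$. The latter equals $\mathcal D\bigl((S+T)^2\bigr)$ and is a subset of $\mathcal F(S,T)$.
   Context: $B$ is a $C^*$-algebra and $E$ a Hilbert-$C^*$-module over $B$ with $B$-valued inner product $\langle\cdot,\cdot\rangle$; inequalities between elements of $B$ are in the order of $B$. $\mathcal D(S)$ denotes the domain of $S$. A self-adjoint operator $S$ in $E$ is regular if $S\pm\lambda$ has dense range for one (hence all) $\lambda\in\mathbb C\setminus\mathbb R$. A core is a submodule of the domain dense in the graph norm. The sum $S+T$ has domain $\mathcal D(S)\cap\mathcal D(T)$. For self-adjoint regular $S,T$ in $E$ put $\mathcal F(S,T)=\{x\in\mathcal D(S)\cap\mathcal D(T): Sx\in\mathcal D(T),\ Tx\in\mathcal D(S)\}$ and $[S,T]=ST+TS$ on $\mathcal F(S,T)$. The pair $(S,T)$ is weakly anticommuting if (1) there are constants $C_0,C_1,C_2>0$ such that for all $x\in\mathcal F(S,T)$: $\langle[S,T]x,[S,T]x\rangle\le C_0\langle x,x\rangle+C_1\langle Sx,Sx\rangle+C_2\langle Tx,Tx\rangle$ in $B$; and (2) there are a core $\mathcal E\subset\mathcal D(T)$ for $T$ and $\lambda_0>0$ such that $(S+\lambda)^{-1}(\mathcal E)\subset\mathcal F(S,T)$ for all $\lambda\in i\mathbb R$, $|\lambda|\ge\lambda_0$. *)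

(* Defs.v *)
From HB Require Import structures.
From mathcomp Require Import all_boot all_order all_algebra.
From mathcomp Require Import all_classical all_reals all_analysis.
From mathcomp Require Import complex.

Set Implicit Arguments.
Unset Strict Implicit.
Unset Printing Implicit Defensive.

Import Order.TTheory GRing.Theory Num.Theory numFieldNormedType.Exports.

Local Open Scope classical_set_scope.
Local Open Scope complex_scope.
Local Open Scope ring_scope.

(* Not assumed unital (nor nonzero), hence not built on the ring hierarchy. *)
HB.mixin Record isCstarAlgebra (R : realType) B
    of CompleteNormedModule R[i] B := {
  cmul : B -> B -> B ;
  cstar : B -> B ;
  cmulA : associative cmul ;
  cmulDl : left_distributive cmul +%R ;
  cmulDr : right_distributive cmul +%R ;
  cmulZl : forall (z : R[i]) (a b : B), cmul (z *: a) b = z *: cmul a b ;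
  cmulZr : forall (z : R[i]) (a b : B), cmul a (z *: b) = z *: cmul a b ;
  cstarK : involutive cstar ;
  cstarD : {morph cstar : a b / a + b} ;
  cstarZ : forall (z : R[i]) (a : B), cstar (z *: a) = z^* *: cstar a ;
  cstarM : forall a b : B, cstar (cmul a b) = cmul (cstar b) (cstar a) ;
  cnormM : forall a b : B, `|cmul a b| <= `|a| * `|b| ;
  cnorm_star : forall a : B, `|cmul (cstar a) a| = `|a| ^+ 2
}.

#[short(type="cstarAlgType")]
HB.structure Definition CstarAlgebra (R : realType) :=
  {B of isCstarAlgebra R B & CompleteNormedModule R[i] B}.

Definition cpos (R : realType) (B : cstarAlgType R) (a : B) : Prop :=
  exists c : B, a = cmul (cstar c) c.

Definition cle (R : realType) (B : cstarAlgType R) (a b : B) : Prop :=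
  cpos (b - a).

(* Right modules, with an inner product linear in its second argument. *)
HB.mixin Record isHilbertModule (R : realType) (B : cstarAlgType R) E
    of CompleteNormedModule R[i] E := {
  mact : E -> B -> E ;
  inner : E -> E -> B ;
  mactA : forall (x : E) (a b : B), mact x (cmul a b) = mact (mact x a) b ;
  mactDl : forall (x y : E) (a : B), mact (x + y) a = mact x a + mact y a ;
  mactDr : forall (x : E) (a b : B), mact x (a + b) = mact x a + mact x b ;
  mactZl : forall (z : R[i]) (x : E) (a : B), mact (z *: x) a = z *: mact x a ;
  mactZr : forall (z : R[i]) (x : E) (a : B), mact x (z *: a) = z *: mact x a ;
  innerD : forall x y z : E, inner x (y + z) = inner x y + inner x z ;
  innerZ : forall (z : R[i]) (x y : E), inner x (z *: y) = z *: inner x y ;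
  innerM : forall (x y : E) (a : B), inner x (mact y a) = cmul (inner x y) a ;
  innerC : forall x y : E, inner y x = cstar (inner x y) ;
  inner_ge0 : forall x : E, cpos (inner x x) ;
  (* in particular, inner x x = 0 implies x = 0 *)
  norm_inner : forall x : E, `|x| ^+ 2 = `|inner x x|
}.

#[short(type="hilbertModType")]
HB.structure Definition HilbertModule (R : realType) (B : cstarAlgType R) :=
  {E of isHilbertModule R B E & CompleteNormedModule R[i] E}.

Arguments mact {R B E} : rename.
Arguments inner {R B E} : rename.

Record submodule_set (R : realType) (B : cstarAlgType R)
    (E : hilbertModType B) (A : set E) : Prop := SubmoduleSet {
  submod0 : A 0 ;
  submodD : forall x y, A x -> A y -> A (x + y) ;
  submodZ : forall (z : R[i]) x, A x -> A (z *: x) ;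
  submodM : forall x (b : B), A x -> A (mact x b)
}.

(* The values of app outside dom are irrelevant: every notion below only      *)
(* depends on the restriction of app to dom.                                  *)
Record operator (R : realType) (B : cstarAlgType R) (E : hilbertModType B) :=
  Operator {
  dom : set E ;
  app :> E -> E ;
  dom_submod : submodule_set dom ;
  appD : forall x y, dom x -> dom y -> app (x + y) = app x + app y ;
  appZ : forall (z : R[i]) x, dom x -> app (z *: x) = z *: app x ;
  appM : forall x (b : B), dom x -> app (mact x b) = mact (app x) b
}.

Section Operators.
Variables (R : realType) (B : cstarAlgType R) (E : hilbertModType B).
Implicit Types S T : operator E.

Definition add_dom S T : set E := dom S `&` dom T.

Lemma add_dom_submod S T : submodule_set (add_dom S T).
Proof.
split; first by split; exact: submod0 (dom_submod _).
- by move=> x y [? ?] [? ?]; split; apply: (submodD (dom_submod _)).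
- by move=> z x [? ?]; split; apply: (submodZ (dom_submod _)).
- by move=> x b [? ?]; split; apply: (submodM (dom_submod _)).
Qed.

Lemma add_appD S T x y : add_dom S T x -> add_dom S T y ->
  S (x + y) + T (x + y) = (S x + T x) + (S y + T y).
Proof. by move=> [? ?] [? ?]; rewrite !appD// addrACA. Qed.

Lemma add_appZ S T (z : R[i]) x : add_dom S T x ->
  S (z *: x) + T (z *: x) = z *: (S x + T x).
Proof. by move=> [? ?]; rewrite !appZ// scalerDr. Qed.

Lemma add_appM S T x (b : B) : add_dom S T x ->
  S (mact x b) + T (mact x b) = mact (S x + T x) b.
Proof. by move=> [? ?]; rewrite !appM// mactDl. Qed.

Definition op_add S T : operator E :=
  @Operator R B E (add_dom S T) (fun x => S x + T x) (add_dom_submod S T)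
    (@add_appD S T) (@add_appZ S T) (@add_appM S T).

Definition comp_dom S T : set E := [set x | dom T x /\ dom S (T x)].

Lemma app0 S : S 0 = 0.
Proof.
by rewrite -(scale0r (0 : E)) appZ ?scale0r//; exact: submod0 (dom_submod _).
Qed.

Lemma comp_dom_submod S T : submodule_set (comp_dom S T).
Proof.
split; first by split; rewrite ?app0; exact: submod0 (dom_submod _).
- move=> x y [? ?] [? ?]; split; rewrite ?appD//;
  exact: (submodD (dom_submod _)).
- by move=> z x [? ?]; split; rewrite ?appZ//; apply: (submodZ (dom_submod _)).
- by move=> x b [? ?]; split; rewrite ?appM//; apply: (submodM (dom_submod _)).
Qed.

Lemma comp_appD S T x y : comp_dom S T x -> comp_dom S T y ->
  S (T (x + y)) = S (T x) + S (T y).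
Proof. by move=> [? ?] [? ?]; rewrite !appD. Qed.

Lemma comp_appZ S T (z : R[i]) x : comp_dom S T x ->
  S (T (z *: x)) = z *: S (T x).
Proof. by move=> [? ?]; rewrite !appZ. Qed.

Lemma comp_appM S T x (b : B) : comp_dom S T x ->
  S (T (mact x b)) = mact (S (T x)) b.
Proof. by move=> [? ?]; rewrite !appM. Qed.

Definition op_comp S T : operator E :=
  @Operator R B E (comp_dom S T) (fun x => S (T x)) (comp_dom_submod S T)
    (@comp_appD S T) (@comp_appZ S T) (@comp_appM S T).

Definition op_sqr S : operator E := op_comp S S.

(* (y, z) lies in the graph of the adjoint of S. *)
Definition adjoint_graph S (y z : E) : Prop :=
  forall x, dom S x -> inner (S x) y = inner x z.

(* S is densely defined and the graph of its adjoint is the graph of S. *)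
Definition self_adjoint S : Prop :=
  dense (dom S) /\
  forall y z, adjoint_graph S y z <-> (dom S y /\ z = S y).

Definition shift_range S (l : R[i]) : set E :=
  [set y | exists2 x, dom S x & y = S x + l *: x].

(* Regularity of a self-adjoint operator. *)
Definition regular S : Prop :=
  exists l : R[i], [/\ complex.Im l != 0,
    dense (shift_range S l) & dense (shift_range S (- l))].

Definition graph_inner T (x y : E) : B := inner x y + inner (T x) (T y).

Definition graph_norm T (x : E) : R[i] := sqrtC `|graph_inner T x x|.

Definition core T (A : set E) : Prop :=
  [/\ submodule_set A, A `<=` dom T &
    forall x, dom T x -> forall e : R, 0 < e ->
      exists2 a, A a & graph_norm T (x - a) < e%:C].

Definition Fdom S T : set E :=
  [set x | [/\ dom S x, dom T x, dom T (S x) & dom S (T x)]].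

Definition anticomm S T (x : E) : E := S (T x) + T (S x).

(* When S is self-adjoint and regular and Im l != 0, S + l is a bijection of  *)
(* dom S onto E, and this is the image of A under its inverse.                *)
Definition resolvent_image S (l : R[i]) (A : set E) : set E :=
  [set x | dom S x /\ A (S x + l *: x)].

Record weakly_anticommuting S T : Prop := WeaklyAnticommuting {
  wac_bound : exists C0 C1 C2 : R, [/\ 0 < C0, 0 < C1, 0 < C2 &
    forall x, Fdom S T x ->
      cle (inner (anticomm S T x) (anticomm S T x))
          (C0%:C *: inner x x + C1%:C *: inner (S x) (S x)
             + C2%:C *: inner (T x) (T x))] ;
  wac_core : exists A : set E, core T A /\
    exists2 l0 : R, 0 < l0 & forall l : R[i], complex.Re l = 0 ->
      l0%:C <= `|l| -> resolvent_image S l A `<=` Fdom S T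
}.

End Operators.

(* Main.v *)
(* Everything rests on J_l = l (S + l)^-1 for large imaginary l. Weak
   anticommutation makes J_l map D(T) into F(S,T), with
     T J_l e = J_-l (T e - l^-1 [S,T] J_l e).

   1. S + T is self-adjoint and regular on D(S) & D(T): solve the Yosida
      approximation S J_l x + T x + t x = y, with l a positive multiple of the
      imaginary number t. For v = J_l x one has x = v + l^-1 S v, and since
      <Sv, T S v> is self-adjoint, the real part of <Sv, y> only sees <Sv, Sv>
      and <v, [S,T] v>, which bounds S v uniformly in l. Truncating by a fixed
      average of resolvents gives uniform control of the tails of S v, so that
      (S + T + t) v tends to y in norm; no weak limits are needed.
   2. |S u| + |T u| <= C (|u| + |S u + T u|) and the same with S u - T u. For x
      in D((S + T)^2), applying S - T to regularisations of S x cancels the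
      uncontrolled terms, whence S x and T x lie in D(S) & D(T).
   3. S^2 + T^2 = (S + T)^2 - [S,T] on D((S + T)^2), and [S,T] is small
      relative to (S + T)^2 + i r for large r, so S^2 + T^2 + i r is already
      onto from D((S + T)^2); being symmetric, S^2 + T^2 has no larger domain.

   The order of B enters only through |a| <= |a + b| for a, b of the form
   c* c, which is Fukamiya's theorem. *)

(* Balls of a Hilbert module need not be weakly compact and closed submodules need not be
   complemented, so solvability has to be produced by hand: preimages come from
   [contraction_fixpoint] or from norm-Cauchy sequences, and self-adjointness together with
   regularity is used as surjectivity of S + l for all non-real l. Lower bounds come from [nm_skew]:
   two vectors whose inner product is skew cannot cancel in norm. The sign change from l to -l in
   the commutation rule is why averages occur. J_l alone does not nearly commute with T, but the
   average of J_l and J_-l does, up to l^-1 times bounded terms. It also commutes with S and with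
   every J_m, so it can be applied to the approximating equation; the a priori bound for the
   difference then controls the tails of S v uniformly in l. For Fukamiya's theorem no functional
   calculus is set up. Positivity of u is read as |z| <= |z + t u z| for t >= 0, which is a
   first-order condition on 1 - e u, and approximate square roots come from an iteration. *)
Require Import Defs.
From HB Require Import structures.
From mathcomp Require Import all_boot all_order all_algebra.
From mathcomp Require Import all_classical all_reals all_analysis.
From mathcomp Require Import complex.
From mathcomp Require Import ring lra.

Set Implicit Arguments.
Unset Strict Implicit.
Unset Printing Implicit Defensive.

Import Order.TTheory GRing.Theory Num.Theory numFieldNormedType.Exports.

Local Open Scope classical_set_scope.
Local Open Scope complex_scope.
Local Open Scope ring_scope.

(** * Linear combinations and real-valued norms *)

Section LinearExpressions.
Variables (K : comNzRingType) (V : lmodType K).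

Inductive lexp :=
  | LVar of nat | LZero | LAdd of lexp & lexp | LOpp of lexp
  | LScale of K & lexp.

Fixpoint leval (env : seq V) e : V :=
  match e with
  | LVar n => env`_n
  | LZero => 0
  | LAdd a b => leval env a + leval env b
  | LOpp a => - leval env a
  | LScale c a => c *: leval env a
  end.

(** The index test is [eqn] rather than [==], so that the [cbn] of [lmod_coefs] can evaluate it
    while leaving the scalars untouched. *)
Fixpoint lcoef e (i : nat) : K :=
  match e with
  | LVar n => if eqn n i then 1 else 0
  | LZero => 0
  | LAdd a b => lcoef a i + lcoef b i
  | LOpp a => - lcoef a i
  | LScale c a => c * lcoef a i
  end.

Lemma levalE env e : leval env e = \sum_(i < size env) lcoef e i *: env`_i.
Proof.
elim: e => [n||a IHa b IHb|a IHa|c a IHa] /=.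
- have [lt_n|le_n] := ltnP n (size env); last first.
    rewrite nth_default// big1// => i _.
    rewrite -[eqn _ _]/(n == i :> nat) gtn_eqF ?scale0r//.
    exact: leq_trans (ltn_ord i) le_n.
  rewrite (bigD1 (Ordinal lt_n))//= -[eqn _ _]/(n == n :> nat) eqxx scale1r.
  rewrite big1 ?addr0// => i ne.
  rewrite -[eqn _ _]/(n == i :> nat) ifF ?scale0r//.
  apply: contraNF ne => /eqP ni.
  by apply/eqP/val_inj.
- by rewrite big1// => i _; rewrite scale0r.
- by rewrite IHa IHb -big_split; apply: eq_bigr => i _; rewrite scalerDl.
- by rewrite IHa -sumrN; apply: eq_bigr => i _; rewrite scaleNr.
- by rewrite IHa scaler_sumr; apply: eq_bigr => i _; rewrite scalerA.
Qed.

Fixpoint lsame n e1 e2 : Prop :=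
  if n is m.+1 then lcoef e1 m = lcoef e2 m /\ lsame m e1 e2 else True.

Lemma lsameP env e1 e2 : lsame (size env) e1 e2 -> leval env e1 = leval env e2.
Proof.
move=> same; rewrite !levalE; apply: eq_bigr => -[i /= lt_i] _.
congr (_ *: _); elim: (size env) lt_i same => //= n IHn.
by rewrite ltnS leq_eqVlt => /orP[/eqP -> []//|lt_i [_ /(IHn lt_i)]].
Qed.

End LinearExpressions.

(** The second branch typechecks exactly when the two atoms are convertible, so that syntactically
    different copies of a vector share one variable. *)
Ltac lmod_lookup x env :=
  match env with
  | cons x _ => constr:(0%N)
  | cons ?y _ => let _ := constr:(erefl x : x = y) in constr:(0%N)
  | cons _ ?l => let n := lmod_lookup x l in constr:(S n)
  end.

Ltac lmod_collect e env :=
  match e with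
  | (?a + ?b)%R => let env1 := lmod_collect a env in lmod_collect b env1
  | (- ?a)%R => lmod_collect a env
  | (_ *: ?a)%R => lmod_collect a env
  | 0%R => env
  | _ => match env with
         | _ => let n := lmod_lookup e env in env
         | _ => constr:(cons e env)
         end
  end.

Ltac lmod_reify K e env :=
  match e with
  | (?a + ?b)%R => let x := lmod_reify K a env in
                   let y := lmod_reify K b env in constr:(@LAdd K x y)
  | (- ?a)%R => let x := lmod_reify K a env in constr:(@LOpp K x)
  | (?c *: ?a)%R => let x := lmod_reify K a env in constr:(@LScale K c x)
  | 0%R => constr:(@LZero K)
  | _ => let n := lmod_lookup e env in constr:(@LVar K n)
  end.

(* Reduces an equality of linear combinations over K to the equalities of the
   coefficients. *)
Ltac lmod_coefs K :=
  match goal with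
  | |- @eq ?V ?a ?b =>
    let env0 := lmod_collect a (@nil V) in
    let env := lmod_collect b env0 in
    let x := lmod_reify K a env in
    let y := lmod_reify K b env in
    apply: (@lsameP _ _ env x y);
    cbn [lsame lcoef size eqn]; repeat split
  end.

Lemma conj_complexE (R : realType) (z : R[i]) : (z^*)%R = (z^*)%C.
Proof. by []. Qed.

Lemma conj_real (R : realType) (r : R) : (r%:C^*)%R = r%:C.
Proof. by rewrite conj_complexE conjc_real. Qed.

Lemma conj_imag (R : realType) (b : R) : ((0 +i* b)^*)%R = - (0 +i* b).
Proof.
by apply/eqP; rewrite conj_complexE eq_complex/= oppr0 !eqxx.
Qed.

Lemma conj_imagN (R : realType) (b : R) : ((- (0 +i* b))^*)%R = 0 +i* b.
Proof. by rewrite rmorphN /= conj_imag opprK. Qed.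

Lemma imag_sqr (R : realType) (b : R) :
  (0 +i* b) * (0 +i* b) = - (b ^+ 2)%:C :> R[i].
Proof.
apply/eqP; rewrite eq_complex/=.
by rewrite !(mulr0, mul0r, addr0, sub0r, oppr0) expr2 !eqxx.
Qed.

(** Serves to pick tolerances of the form e / (C + 1) without a case distinction on C = 0. *)
Lemma divD1_mul_le (R : realFieldType) (x y : R) :
  0 <= x -> 0 <= y -> x / (y + 1) * y <= x.
Proof.
move=> x0 y0; rewrite mulrAC ler_pdivrMr ?ltr_wpDl//.
by rewrite ler_wpM2l// lerDl.
Qed.

Section Norm.
Variable R : realType.
Implicit Types V : normedZmodType R[i].

(** The norm of the hierarchy takes values in [R[i]]; a real-valued copy makes [lra] and [nra]
    available. *)
Definition nm V (x : V) : R := complex.Re `|x|.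

Lemma nmE V (x : V) : `|x| = (nm x)%:C.
Proof. by rewrite /nm RRe_real// normr_real. Qed.

Lemma nm_ge0 V (x : V) : 0 <= nm x.
Proof. by rewrite -ler0c -nmE normr_ge0. Qed.

Lemma nm0 V : nm (0 : V) = 0.
Proof. by rewrite /nm normr0. Qed.

Lemma nm_eq0 V (x : V) : nm x = 0 -> x = 0.
Proof. by move=> x0; apply/normr0_eq0; rewrite nmE x0. Qed.

Lemma nmD V (x y : V) : nm (x + y) <= nm x + nm y.
Proof. by rewrite -lecR rmorphD/= -!nmE ler_normD. Qed.

Lemma nmN V (x : V) : nm (- x) = nm x.
Proof. by rewrite /nm normrN. Qed.

Lemma nmB V (x y : V) : nm (x - y) <= nm x + nm y.
Proof. by rewrite -(nmN y) nmD. Qed.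

Lemma nm_subC V (x y : V) : nm (x - y) = nm (y - x).
Proof. by rewrite -nmN opprB. Qed.

Lemma nm_sub_trans V (y x z : V) : nm (x - z) <= nm (x - y) + nm (y - z).
Proof. by rewrite -(subrKA y) nmD. Qed.

Lemma nm_le_sub V (x y : V) : nm x <= nm y + nm (x - y).
Proof. by rewrite -{1}(subrKC y x) nmD. Qed.

Lemma nmZ (V : normedModType R[i]) (c : R[i]) (x : V) :
  nm (c *: x) = nm c * nm x.
Proof. by apply: complexI; rewrite rmorphM/= -!nmE normrZ. Qed.

Lemma nmR (r : R) : nm r%:C = `|r|.
Proof. by rewrite /nm normc_def/= expr0n/= addr0 sqrtr_sqr. Qed.

Lemma nmI (r : R) : nm (0 +i* r) = `|r|.
Proof. by rewrite /nm normc_def/= expr0n/= add0r sqrtr_sqr. Qed.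

Lemma nmcM (a b : R[i]) : nm (a * b) = nm a * nm b.
Proof. by apply: complexI; rewrite rmorphM/= -!nmE normrM. Qed.

Lemma nmcV (a : R[i]) : nm a^-1 = (nm a)^-1.
Proof. by apply: complexI; rewrite fmorphV/= -!nmE normfV. Qed.

Lemma nm_gt0 V (x : V) : x != 0 -> 0 < nm x.
Proof.
by move=> x0; rewrite lt_def nm_ge0 andbT; apply: contra_neq x0 => /nm_eq0.
Qed.

End Norm.

(** * Positivity in C*-algebras *)

Section Cstar.
Variables (R : realType) (B : cstarAlgType R).
Implicit Types a b z w : B.

Lemma cmul0r a : cmul a 0 = 0.
Proof. by rewrite -[X in cmul a X](scale0r (0 : B)) cmulZr scale0r. Qed.

Lemma cmul0l a : cmul 0 a = 0.
Proof. by rewrite -[X in cmul X a](scale0r (0 : B)) cmulZl scale0r. Qed.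

Lemma cstar0 : cstar 0 = 0 :> B.
Proof.
by apply: (addrI (cstar 0)); rewrite -cstarD !addr0.
Qed.

Lemma cstarN a : cstar (- a) = - cstar a.
Proof. by apply: (addrI (cstar a)); rewrite -cstarD !subrr cstar0. Qed.

Lemma nm_cmul a b : nm (cmul a b) <= nm a * nm b.
Proof. by rewrite -lecR rmorphM/= -!nmE cnormM. Qed.

Lemma nm_cstar_cmul a : nm (cmul (cstar a) a) = nm a ^+ 2.
Proof. by apply: complexI; rewrite rmorphXn/= -!nmE cnorm_star. Qed.

Lemma nm_cstar a : nm (cstar a) = nm a.
Proof.
suff le_nm b : nm b <= nm (cstar b).
  by apply/eqP; rewrite eq_le le_nm andbT -[leRHS](congr1 (@nm _ _) (cstarK a)).
have [->|b0] := eqVneq b 0; first by rewrite cstar0.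
have := nm_cmul (cstar b) b.
by rewrite nm_cstar_cmul expr2 ler_pM2r ?nm_gt0.
Qed.

End Cstar.

(* B with a unit adjoined; it acts on B by left multiplication. *)
Definition unitization (R : realType) (B : cstarAlgType R) : Type :=
  (R[i]^o * B)%type.

HB.instance Definition _ (R : realType) (B : cstarAlgType R) :=
  GRing.Lmodule.copy (unitization B) (R[i]^o * B)%type.

(** * The unitization, its action on B, and accretive elements *)

Section Unitization.
Variables (R : realType) (B : cstarAlgType R).
Local Notation U := (unitization B).
Implicit Types u v : U.

Definition umul u v : U :=
  (u.1 * v.1, u.1 *: v.2 + v.1 *: u.2 + cmul u.2 v.2).
Definition uone : U := (1, 0).

Lemma umulA : associative umul.
Proof.
move=> [a x] [b y] [c z]; rewrite /umul/=; congr (_, _); first by rewrite mulrA.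
rewrite !cmulDl !cmulDr !cmulZl !cmulZr cmulA.
by lmod_coefs R[i]; ring.
Qed.

Lemma umul1r : left_id uone umul.
Proof.
move=> [a x]; rewrite /umul/= mul1r cmul0l; congr (_, _).
by lmod_coefs R[i]; ring.
Qed.

Lemma umulr1 : right_id uone umul.
Proof.
move=> [a x]; rewrite /umul/= mulr1 cmul0r; congr (_, _).
by lmod_coefs R[i]; ring.
Qed.

Lemma umulDl : left_distributive umul +%R.
Proof.
move=> [a x] [b y] [c z]; rewrite /umul/=; congr (_, _); first by rewrite mulrDl.
by rewrite !cmulDl/=; lmod_coefs R[i]; ring.
Qed.

Lemma umulDr : right_distributive umul +%R.
Proof.
move=> [a x] [b y] [c z]; rewrite /umul/=; congr (_, _); first by rewrite mulrDr.
by rewrite !cmulDr/=; lmod_coefs R[i]; ring.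
Qed.

Lemma uone_neq0 : uone != 0.
Proof. by apply/eqP => -[/eqP]; rewrite oner_eq0. Qed.

HB.instance Definition _ := GRing.Zmodule_isNzRing.Build U
  umulA umul1r umulr1 umulDl umulDr uone_neq0.

Lemma uscaleAl (c : R[i]) u v : c *: (u * v) = (c *: u) * v.
Proof.
case: u v => [a x] [b y]; congr (_, _); rewrite /= /umul/=.
  exact: mulrA.
rewrite cmulZl.
by lmod_coefs R[i]; rewrite /GRing.scale/=; ring.
Qed.

HB.instance Definition _ := GRing.Lmodule_isLalgebra.Build R[i] U uscaleAl.

Lemma uscaleAr (c : R[i]) u v : c *: (u * v) = u * (c *: v).
Proof.
case: u v => [a x] [b y]; congr (_, _); rewrite /= /umul/=.
  exact: mulrCA.
rewrite cmulZr.
by lmod_coefs R[i]; rewrite /GRing.scale/=; ring.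
Qed.

HB.instance Definition _ := GRing.Lalgebra_isAlgebra.Build R[i] U uscaleAr.

Definition ustar u : U := (u.1^*, cstar u.2).

Lemma ustarK : involutive ustar.
Proof. by case=> a x; rewrite /ustar/= conjCK cstarK. Qed.

Lemma ustarD u v : ustar (u + v) = ustar u + ustar v.
Proof. by congr (_, _); rewrite /= ?rmorphD// cstarD. Qed.

Lemma ustarN u : ustar (- u) = - ustar u.
Proof. by congr (_, _); rewrite /= ?rmorphN// cstarN. Qed.

Lemma ustarZ (c : R[i]) u : ustar (c *: u) = c^* *: ustar u.
Proof. by congr (_, _); rewrite /= ?cstarZ//; exact: rmorphM. Qed.

Lemma ustar1 : ustar 1 = 1.
Proof. by congr (_, _); rewrite /= ?rmorph1 ?cstar0. Qed.

Lemma ustarM u v : ustar (u * v) = ustar v * ustar u.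
Proof.
case: u v => [a x] [b y]; congr (_, _); rewrite /= ?rmorphM 1?mulrC//.
rewrite !cstarD !cstarZ cstarM.
by lmod_coefs R[i]; ring.
Qed.

Definition act u (z : B) : B := u.1 *: z + cmul u.2 z.

Lemma actD u z w : act u (z + w) = act u z + act u w.
Proof. by rewrite /act cmulDr; lmod_coefs R[i]; ring. Qed.

Lemma actZ u (c : R[i]) z : act u (c *: z) = c *: act u z.
Proof. by rewrite /act cmulZr; lmod_coefs R[i]; ring. Qed.

Lemma act_add u v z : act (u + v) z = act u z + act v z.
Proof. by rewrite /act/= cmulDl; lmod_coefs R[i]; ring. Qed.

Lemma act_scale (c : R[i]) u z : act (c *: u) z = c *: act u z.
Proof.
by rewrite /act/= cmulZl; lmod_coefs R[i]; rewrite /GRing.scale/=; ring.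
Qed.

Lemma act_opp u z : act (- u) z = - act u z.
Proof. by rewrite -scaleN1r act_scale scaleN1r. Qed.

Lemma act1 z : act 1 z = z.
Proof. by rewrite /act/= cmul0l scale1r addr0. Qed.

Lemma actM u v z : act (u * v) z = act u (act v z).
Proof.
rewrite /act/= !cmulDl !cmulDr !cmulZl !cmulZr cmulA.
by lmod_coefs R[i]; ring.
Qed.

(** [act (ustar u)] is the adjoint of [act u] for the B-valued inner product z* w on B. *)
Lemma act_adj u z w : cmul (cstar (act u z)) w = cmul (cstar z) (act (ustar u) w).
Proof.
rewrite /act/= cstarD cstarZ cstarM !cmulDl !cmulDr !cmulZl !cmulZr cmulA.
by lmod_coefs R[i]; ring.
Qed.

(** Operator bounds on B replace a norm on the unitization. The least M is only a seminorm of u when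
    B already has a unit, and that suffices. *)
Definition bnd u (M : R) := forall z, nm (act u z) <= M * nm z.
Definition sa u := ustar u = u.
(* For self-adjoint u this is positivity, in a form that is stable under sums
   and needs no functional calculus. *)
Definition acc u := forall (t : R) z, 0 <= t -> nm z <= nm (z + t%:C *: act u z).

Lemma ex_bnd u : exists2 M : R, 0 <= M & bnd u M.
Proof.
exists (nm u.1 + nm u.2); first by rewrite addr_ge0 ?nm_ge0.
move=> z; rewrite /act mulrDl -nmZ; apply: le_trans (nmD _ _) _.
by rewrite lerD2l nm_cmul.
Qed.

Lemma bndM u v (M N : R) : 0 <= M -> bnd u M -> bnd v N -> bnd (u * v) (M * N).
Proof.
move=> M0 uM vN z; rewrite actM -mulrA; apply: le_trans (uM _) _.
by rewrite ler_wpM2l.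
Qed.

Lemma bndD u v (M N : R) : bnd u M -> bnd v N -> bnd (u + v) (M + N).
Proof. by move=> uM vN z; rewrite act_add mulrDl (le_trans (nmD _ _))// lerD. Qed.

Lemma bndZ u (M : R) (c : R[i]) : bnd u M -> bnd (c *: u) (nm c * M).
Proof. by move=> uM z; rewrite act_scale nmZ -mulrA ler_wpM2l ?nm_ge0. Qed.

Lemma bndW u (M N : R) : M <= N -> bnd u M -> bnd u N.
Proof. by move=> MN uM z; rewrite (le_trans (uM _))// ler_wpM2r ?nm_ge0. Qed.

Lemma bnd1 : bnd 1 1.
Proof. by move=> z; rewrite act1 mul1r. Qed.

Lemma nm_act_sqr u z : nm (act u z) ^+ 2 <= nm z * nm (act (ustar u * u) z).
Proof.
rewrite -nm_cstar_cmul act_adj -actM (le_trans (nm_cmul _ _))//.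
by rewrite nm_cstar.
Qed.

Lemma saM u v : sa u -> sa v -> u * v = v * u -> sa (u * v).
Proof. by rewrite /sa ustarM => -> -> ->. Qed.

Lemma saD u v : sa u -> sa v -> sa (u + v).
Proof. by rewrite /sa ustarD => -> ->. Qed.

Lemma saN u : sa u -> sa (- u).
Proof. by rewrite /sa ustarN => ->. Qed.

Lemma saZ u (r : R) : sa u -> sa (r%:C *: u).
Proof. by rewrite /sa ustarZ conj_real => ->. Qed.

Lemma sa1 : sa 1. Proof. exact: ustar1. Qed.

Lemma sa_sq u : sa (ustar u * u).
Proof. by rewrite /sa ustarM ustarK. Qed.

(* (1 + isu) and its adjoint (1 - isu) have the same norms on B, and their
   average is 1. *)
Lemma acc_sqr u : sa u -> acc (u * u).
Proof.
move=> sau t z t0; pose s := Num.sqrt t.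
have st : s * s = t by rewrite -expr2 sqr_sqrtr.
pose v : U := 1 + (0 +i* s) *: u.
have vs : ustar v = 1 - (0 +i* s) *: u.
  rewrite /v ustarD ustar1 ustarZ sau -scaleNr; congr (_ + _ *: _).
  exact: conj_imag.
have cS : (0 +i* s) * (0 +i* s) = - t%:C :> R[i].
  by rewrite imag_sqr expr2 st.
have vv : ustar v * v = 1 + t%:C *: (u * u).
  rewrite vs /v mulrBl mul1r mulrDr mulr1 -scalerAl -scalerAr scalerA cS.
  by rewrite scaleNr; lmod_coefs R[i]; ring.
have vv' : v * ustar v = 1 + t%:C *: (u * u).
  rewrite vs /v mulrBr mulr1 mulrDl mul1r -scalerAl -scalerAr scalerA cS.
  by rewrite scaleNr; lmod_coefs R[i]; ring.
have sym : nm (act (ustar v) z) = nm (act v z).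
  have : nm (act (ustar v) z) ^+ 2 = nm (act v z) ^+ 2.
    by rewrite -!nm_cstar_cmul !act_adj -!actM ustarK vv vv'.
  by move/eqP; rewrite eqrXn2 ?nm_ge0// => /eqP.
have le_v : nm z <= nm (act v z).
  have : act v z + act (ustar v) z = 2%:R%:C *: z.
    rewrite vs /v !act_add act_opp !act1.
    by lmod_coefs R[i]; rewrite ?rmorph_nat; ring.
  move=> /(congr1 (@nm _ _)); rewrite nmZ nmR ger0_norm// => e.
  by have := nmD (act v z) (act (ustar v) z); rewrite e sym; lra.
have := nm_act_sqr v z; rewrite vv (act_add 1 (_ *: (u * u))) act1 act_scale.
have [->|z0] := eqVneq z 0; first by rewrite nm0 nm_ge0.
move=> le2; rewrite -(ler_pM2l (nm_gt0 z0)) (le_trans _ le2)//.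
by rewrite -expr2 lerXn2r ?nnegrE ?nm_ge0.
Qed.

(** Apply accretivity to (1 - e u) z and use (1 + e u)(1 - e u) = 1 - e^2 u^2. With the converse
    [bnd_acc], accretivity becomes |1 - e u| <= 1 + O(e^2), a condition that is convex in u. *)
Lemma acc_bnd u (M e : R) : 0 <= M -> bnd u M -> acc u -> 0 <= e ->
  bnd (1 - e%:C *: u) (1 + e ^+ 2 * M ^+ 2).
Proof.
move=> M0 uM accu e0 z; rewrite act_add act1 act_opp act_scale.
have /le_trans -> // := accu e (z - e%:C *: act u z) e0.
have -> : z - e%:C *: act u z + e%:C *: act u (z - e%:C *: act u z) =
    z - (e ^+ 2)%:C *: act u (act u z).
  rewrite actD -scaleNr actZ; lmod_coefs R[i]; rewrite ?rmorphXn/=; ring.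
apply: le_trans (nmB _ _) _; rewrite mulrDl mul1r lerD2l nmZ nmR.
rewrite ger0_norm ?sqr_ge0// -mulrA ler_wpM2l ?sqr_ge0// expr2 -mulrA.
by rewrite (le_trans (uM _))// ler_wpM2l.
Qed.

(** From (t + e) z = t (1 - e u) z + e (1 + t u) z follows |z| <= |(1 + t u) z| + e t C |z|; then e
    tends to 0. *)
Lemma bnd_acc u (C : R) : 0 <= C ->
  (forall e : R, 0 < e -> bnd (1 - e%:C *: u) (1 + e ^+ 2 * C)) -> acc u.
Proof.
move=> C0 uC t z t0.
have le_e (e : R) : 0 < e -> nm z <= nm (z + t%:C *: act u z) + e * (t * C * nm z).
  move=> e0; have := uC e e0 z; rewrite act_add act1 act_opp act_scale => le1.
  have := nmD (t%:C *: (z - e%:C *: act u z)) (e%:C *: (z + t%:C *: act u z)).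
  have -> : t%:C *: (z - e%:C *: act u z) + e%:C *: (z + t%:C *: act u z) =
      (t + e)%:C *: z by lmod_coefs R[i]; rewrite ?rmorphD/=; ring.
  rewrite !nmZ !nmR (ger0_norm t0) (gtr0_norm e0) gtr0_norm ?ltr_wpDl// => le2.
  rewrite -(ler_pM2l e0); have := ler_wpM2l t0 le1; nra.
apply/ler_addgt0Pr => d d0.
have D0 : 0 <= t * C * nm z by rewrite !mulr_ge0 ?nm_ge0.
have := le_e (d / (t * C * nm z + 1)) (divr_gt0 d0 (ltr_wpDl D0 ltr01)).
by move=> /le_trans; apply; rewrite lerD2l (divD1_mul_le (ltW d0) D0).
Qed.

(** 1 - e (u + v) is the midpoint of 1 - 2 e u and 1 - 2 e v, whose excesses over 1 are of order
    e^2. *)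
Lemma accD u v : acc u -> acc v -> acc (u + v).
Proof.
move=> accu accv; have [M M0 uM] := ex_bnd u; have [N N0 vN] := ex_bnd v.
apply: (@bnd_acc _ (2 * (M ^+ 2 + N ^+ 2))).
  by rewrite mulr_ge0 ?addr_ge0 ?sqr_ge0.
move=> e e0; have e2 : 0 <= 2 * e by rewrite mulr_ge0// ltW.
have := bndZ (2^-1)%:C (bndD (acc_bnd M0 uM accu e2) (acc_bnd N0 vN accv e2)).
have -> : (2^-1)%:C *: (1 - (2 * e)%:C *: u + (1 - (2 * e)%:C *: v)) =
    1 - e%:C *: (u + v).
  by lmod_coefs R[i]; rewrite ?rmorphM ?fmorphV/= ?rmorph_nat; field.
by move=> le_b; apply: bndW le_b; rewrite nmR ger0_norm ?invr_ge0//; lra.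
Qed.

Lemma accZ u (r : R) : 0 <= r -> acc u -> acc (r%:C *: u).
Proof.
move=> r0 accu t z t0; rewrite act_scale scalerA -rmorphM.
by apply: accu; rewrite mulr_ge0.
Qed.

Lemma acc_cvg u : (forall e : R, 0 < e -> exists2 v, acc v & bnd (u - v) e) ->
  acc u.
Proof.
move=> near_u t z t0; apply/ler_addgt0Pr => d d0.
have D0 : 0 <= t * nm z by rewrite mulr_ge0 ?nm_ge0.
have [v accv uv] := near_u _ (divr_gt0 d0 (ltr_wpDl D0 ltr01)).
apply: le_trans (accv _ _ t0) _.
have -> : z + t%:C *: act v z =
    z + t%:C *: act u z - t%:C *: act (u - v) z.
  by rewrite act_add act_opp; lmod_coefs R[i]; ring.
apply: le_trans (nmB _ _) _; rewrite lerD2l nmZ nmR ger0_norm//.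
apply: le_trans (ler_wpM2l t0 (uv z)) _.
by rewrite mulrCA (divD1_mul_le (ltW d0) D0).
Qed.

Lemma bnd_acc1 u (b : R) : bnd u b -> acc (b%:C *: 1 - u).
Proof.
move=> ub t z t0; rewrite act_add act_opp act_scale act1.
have [b0|b0] := leP 0 b; last first.
  suff -> : z = 0 by rewrite nm0 nm_ge0.
  apply: nm_eq0; apply/eqP; rewrite eq_le nm_ge0 andbT.
  by rewrite -(ler_nM2l b0) mulr0 (le_trans _ (ub z))// nm_ge0.
have : (1 + t * b)%:C *: z =
    z + t%:C *: (b%:C *: z - act u z) + t%:C *: act u z.
  by lmod_coefs R[i]; rewrite rmorphD rmorphM/=; ring.
move=> /(congr1 (@nm _ _)); rewrite nmZ nmR ger0_norm ?addr_ge0 ?mulr_ge0//.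
move=> e; have := nmD (z + t%:C *: (b%:C *: z - act u z)) (t%:C *: act u z).
rewrite -e nmZ nmR ger0_norm//; have := ler_wpM2l t0 (ub z); lra.
Qed.

End Unitization.

Lemma geometric_small (R : realType) (q K e : R) : 0 <= q < 1 -> 0 <= K ->
  0 < e -> exists n, forall m, (n <= m)%N -> K * q ^+ m <= e.
Proof.
move=> /andP[q0 q1] K0 e0.
have := @cvg_expr R q; rewrite ger0_norm// => /(_ q1)/cvgr0Pnorm_lt.
move=> /(_ _ (divr_gt0 e0 (ltr_wpDl K0 ltr01)))[n _ small]; exists n => m nm.
have := small m nm; rewrite /= ger0_norm ?exprn_ge0// => /ltW le_q.
by rewrite (le_trans (ler_wpM2l K0 le_q))// mulrC divD1_mul_le// ltW.
Qed.

(** * Approximate square roots of accretive elements *)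

Section Square_roots.
Variables (R : realType) (B : cstarAlgType R).
Local Notation U := (unitization B).
Implicit Types a r u v w : U.

(* The fixed point iteration for g = (r + g^2)/2, i.e. (1 - g)^2 = 1 - r. *)
Fixpoint sqrt_iter r (n : nat) : U :=
  if n is n'.+1 then
    (2^-1)%:C *: (r + sqrt_iter r n' * sqrt_iter r n')
  else 0.

Lemma sqrt_iter_comm r w n : w * r = r * w ->
  w * sqrt_iter r n = sqrt_iter r n * w.
Proof.
move=> wr; elim: n => [|n IHn] /=; first by rewrite mulr0 mul0r.
by rewrite -scalerAr -scalerAl mulrDr mulrDl wr mulrA IHn -!mulrA IHn.
Qed.

Lemma sqrt_iter_sa r n : sa r -> sa (sqrt_iter r n).
Proof.
move=> sar; elim: n => [|n IHn] /=.
  by rewrite /sa -(subrr 1) ustarD ustarN ustar1.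
by apply/saZ/saD => //; apply: saM.
Qed.

Lemma bnd0 (M : R) : 0 <= M -> bnd (0 : U) M.
Proof.
move=> M0 z; rewrite -(scale0r (0 : U)) act_scale scale0r nm0.
by rewrite mulr_ge0 ?nm_ge0.
Qed.

Lemma sqrt_iter_bnd r (q : R) n : 0 <= q <= 1 -> bnd r q ->
  bnd (sqrt_iter r n) q.
Proof.
move=> /andP[q0 q1] rq; elim: n => [|n IHn] /=; first exact: bnd0.
have := bndZ (2^-1)%:C (bndD rq (bndM q0 IHn IHn)).
apply: bndW; rewrite nmR ger0_norm ?invr_ge0//.
by have := ler_wpM2l q0 q1; lra.
Qed.

(** g'^2 - g^2 = g' (g' - g) + (g' - g) g holds without commutation, and each outer factor
    contributes one q. *)
Lemma sqrt_iter_step r (q : R) n : 0 <= q <= 1 -> bnd r q ->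
  bnd (sqrt_iter r n.+1 - sqrt_iter r n) (q ^+ n.+1).
Proof.
move=> q01 rq; have /andP[q0 q1] := q01; elim: n => [|n IHn].
  rewrite /= mul0r addr0 subr0 expr1.
  by apply: bndW (bndZ _ rq); rewrite nmR ger0_norm ?invr_ge0//; lra.
set g := sqrt_iter r.
have -> : g n.+2 - g n.+1 =
    (2^-1)%:C *: (g n.+1 * (g n.+1 - g n) + (g n.+1 - g n) * g n).
  have gS m : g m.+1 = (2^-1)%:C *: (r + g m * g m) by [].
  rewrite mulrBr mulrBl gS [X in _ - X = _]gS.
  by lmod_coefs R[i]; ring.
have gq m : bnd (g m) q by exact: sqrt_iter_bnd.
have := bndZ (2^-1)%:C (bndD (bndM q0 (gq n.+1) IHn)
  (bndM (exprn_ge0 n.+1 q0) IHn (gq n))).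
apply: bndW; rewrite nmR ger0_norm ?invr_ge0// [q ^+ n.+2]exprS; lra.
Qed.

(** The iteration needs |r| <= q < 1, while [acc_bnd] only gives |1 - d a| <= 1 + d^2 M^2. Dividing
    by the slightly larger t = 1 + d^2 N repairs this; then (t / d)(1 - r) = a + (t - 1) / d, a
    shift of a by d N = e / 2. *)
Lemma acc_sqrt a (e : R) : sa a -> acc a -> 0 < e -> exists v : U,
  [/\ sa v, forall w, w * a = a * w -> w * v = v * w & bnd (a - v * v) e].
Proof.
move=> saa acca e0; have [M M0 aM] := ex_bnd a.
pose N := M ^+ 2 + 1; have N0 : 0 < N by rewrite ltr_wpDl ?sqr_ge0.
pose d := e / 2 / N; have d0 : 0 < d by rewrite !divr_gt0.
have dN : d * N = e / 2 by rewrite divfK ?gt_eqF.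
pose t := 1 + d ^+ 2 * N.
have t0 : 0 < t by rewrite ltr_wpDr// mulr_ge0 ?sqr_ge0 ?ltW.
pose q := (1 + d ^+ 2 * M ^+ 2) / t.
have q0 : 0 <= q.
  rewrite divr_ge0 ?(ltW t0)//.
  by have := mulr_ge0 (sqr_ge0 d) (sqr_ge0 M); lra.
have q1 : q < 1.
  by rewrite ltr_pdivrMr// mul1r ltrD2l ltr_pM2l ?exprn_gt0// ltrDl ltr01.
pose r := (t^-1)%:C *: (1 - d%:C *: a).
have rq : bnd r q.
  have := bndZ (t^-1)%:C (acc_bnd M0 aM acca (ltW d0)).
  by apply: bndW; rewrite nmR ger0_norm ?invr_ge0 ?(ltW t0)// mulrC.
have K0 : 0 <= 2 * t / d by rewrite divr_ge0 ?(ltW d0)// mulr_ge0 ?(ltW t0).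
have e20 : 0 < e / 2 by rewrite divr_gt0.
have [n small] := geometric_small (introT andP (conj q0 q1)) K0 e20.
pose g := sqrt_iter r n; pose s := Num.sqrt (t / d).
have ss : s%:C * s%:C = (t / d)%:C.
  by rewrite -rmorphM -expr2 sqr_sqrtr// divr_ge0 ?ltW.
have dNt : e / 2 = (t - 1) / d by rewrite -dN /t; field; rewrite gt_eqF.
clearbody t d.
exists (s%:C *: (1 - g)); split.
- apply/saZ/saD; first exact: sa1.
  apply/saN/sqrt_iter_sa/saZ/saD; first exact: sa1.
  exact/saN/saZ.
- move=> w wa; rewrite -scalerAr -scalerAl mulrBr mulrBl mulr1 mul1r.
  rewrite sqrt_iter_comm// -scalerAr -scalerAl mulrBr mulrBl mulr1 mul1r.
  by rewrite -scalerAr -scalerAl wa.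
(* (1 - g)^2 misses 1 - r by twice the next increment of the iteration, which takes up the other e /
   2. *)
have -> : a - s%:C *: (1 - g) * (s%:C *: (1 - g)) =
    - (e / 2)%:C *: 1 - (2 * t / d)%:C *: (sqrt_iter r n.+1 - g).
  rewrite -scalerAl -scalerAr scalerA ss /= -/g mulrBl mul1r mulrBr mulr1.
  have dC : d%:C != 0 by rewrite fmorph_eq0 gt_eqF.
  have tC : t%:C != 0 by rewrite fmorph_eq0 gt_eqF.
  rewrite dNt /r.
  by lmod_coefs R[i]; rewrite ?(rmorphB, rmorphM, fmorphV)/= ?rmorph_nat ?rmorph1;
    field; rewrite ?dC ?tC.
have := bndD (bndZ (- (e / 2)%:C) (@bnd1 _ B))
  (bndZ (- (2 * t / d)%:C) (sqrt_iter_step n (introT andP (conj q0 (ltW q1))) rq)).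
rewrite (scaleNr (2 * t / d)%:C) => le_e; apply: bndW le_e.
rewrite !nmN !nmR !ger0_norm ?(ltW e20)// mulr1.
by have := small _ (leqnSn n); lra.
Qed.

(** Approximate roots v of a and w of b commute, because v commutes with b and hence with w; so a b
    is near v^2 w^2 = (v w)^2, a self-adjoint square. *)
Lemma accM a b : sa a -> sa b -> acc a -> acc b -> a * b = b * a -> acc (a * b).
Proof.
move=> saa sab acca accb ab; apply: acc_cvg => e e0.
have [N N0 bN] := ex_bnd b.
have e20 : 0 < e / 2 by rewrite divr_gt0.
have [v [sav vcomm av]] :=
  acc_sqrt saa acca (divr_gt0 e20 (ltr_wpDl N0 ltr01)).
have [M M0 vM] := ex_bnd (v * v).
have [w [saw wcomm bw]] :=
  acc_sqrt sab accb (divr_gt0 e20 (ltr_wpDl M0 ltr01)).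
have vb : v * b = b * v by rewrite vcomm.
have vw : v * w = w * v by rewrite wcomm.
exists ((v * w) * (v * w)); first by apply: acc_sqr; apply: saM.
have -> : a * b - v * w * (v * w) = (a - v * v) * b + v * v * (b - w * w).
  rewrite mulrBl mulrBr subrKA; congr (_ - _).
  by rewrite -mulrA (mulrA w) -vw -!mulrA.
have c0 : 0 <= e / 2 / (N + 1) by rewrite divr_ge0 ?ltW// ltr_wpDl.
have := bndD (bndM c0 av bN) (bndM M0 vM bw); apply: bndW.
have := divD1_mul_le (ltW e20) N0; have := divD1_mul_le (ltW e20) M0.
by rewrite [M * _]mulrC; lra.
Qed.

(** With v^2 near b^2 - a^2 and v commuting with a, a is the real part of the normal element p = a +
    i v, and p* p = a^2 + v^2 is near b^2. *)
Lemma bnd_acc_sqr a (b : R) : 0 <= b -> sa a -> acc ((b ^+ 2)%:C *: 1 - a * a) ->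
  bnd a b.
Proof.
move=> b0 saa accb z.
have [->|z0] := eqVneq z 0.
  by rewrite /act scaler0 cmul0r addr0 nm0 mulr0.
rewrite -ler_sqr ?nnegrE ?mulr_ge0 ?nm_ge0//.
have le_e (e : R) : 0 < e -> nm (act a z) ^+ 2 <= (b * nm z) ^+ 2 + e * nm z ^+ 2.
  move=> e0; have sab : sa ((b ^+ 2)%:C *: 1 - a * a).
    by apply: saD; [exact/saZ/sa1|exact/saN/saM].
  have [v [sav vcomm bv]] := acc_sqrt sab accb e0.
  have av : a * v = v * a.
    apply: vcomm; rewrite mulrBl mulrBr -scalerAl -scalerAr mul1r mulr1.
    by rewrite mulrA.
  pose i : R[i] := 0 +i* 1; have ii : i * i = -1.
    by rewrite imag_sqr expr1n.
  pose p : U := a + i *: v; have ps : ustar p = a - i *: v.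
    rewrite /p ustarD saa ustarZ sav -scaleNr; congr (_ + _ *: _).
    by apply/eqP; rewrite conj_complexE eq_complex/= oppr0 !eqxx.
  have pp : ustar p * p = a * a + v * v.
    rewrite ps /p mulrBl !mulrDr -!scalerAl -!scalerAr scalerA ii av.
    by rewrite scaleN1r; lmod_coefs R[i]; ring.
  have pp' : p * ustar p = a * a + v * v.
    rewrite ps /p mulrDl !mulrBr -!scalerAl -!scalerAr scalerA ii av.
    by rewrite scaleN1r; lmod_coefs R[i]; ring.
  have sym : nm (act (ustar p) z) = nm (act p z).
    have : nm (act (ustar p) z) ^+ 2 = nm (act p z) ^+ 2.
      by rewrite -!nm_cstar_cmul !act_adj -!actM ustarK pp pp'.
    by move/eqP; rewrite eqrXn2 ?nm_ge0// => /eqP.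
  have le_p : nm (act a z) <= nm (act p z).
    have : act p z + act (ustar p) z = 2%:R%:C *: act a z.
      rewrite ps /p !act_add act_opp.
      by lmod_coefs R[i]; rewrite ?rmorph_nat; ring.
    move=> /(congr1 (@nm _ _)); rewrite nmZ nmR ger0_norm// => e'.
    by have := nmD (act p z) (act (ustar p) z); rewrite e' sym; lra.
  have : nm (act p z) ^+ 2 <= nm z * (b ^+ 2 * nm z + e * nm z).
    apply: le_trans (nm_act_sqr p z) _; rewrite pp ler_wpM2l ?nm_ge0//.
    have -> : a * a + v * v =
        (b ^+ 2)%:C *: 1 - ((b ^+ 2)%:C *: 1 - a * a - v * v).
      by lmod_coefs R[i]; ring.
    rewrite act_add act_opp act_scale act1; apply: le_trans (nmB _ _) _.
    by rewrite nmZ nmR ger0_norm ?sqr_ge0// lerD2l.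
  have := nm_ge0 (act a z); move: (nm_ge0 (act p z)) le_p; nra.
apply/ler_addgt0Pr => d d0.
have zz0 : 0 < nm z ^+ 2 by rewrite exprn_gt0 ?nm_gt0.
by have := le_e _ (divr_gt0 d0 zz0); rewrite divfK ?gt_eqF.
Qed.

End Square_roots.

(** * Accretivity of x* x and comparison of norms *)

Section Positivity.
Variables (R : realType) (B : cstarAlgType R).
Local Notation U := (unitization B).
Implicit Types h x : U.

Lemma acc1 : acc (1 : U).
Proof. by rewrite -[1]mulr1; apply: acc_sqr; exact: sa1. Qed.

Lemma acc_sum_sqr x : acc (x * ustar x + ustar x * x).
Proof.
pose i : R[i] := 0 +i* 1; have ii : i * i = -1.
  by rewrite imag_sqr expr1n.
pose p := x + ustar x; pose q := i *: (x - ustar x).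
have sap : sa p by rewrite /sa ustarD ustarK addrC.
have saq : sa q.
  rewrite /sa ustarZ ustarD ustarN ustarK.
  have -> : (i^*)%R = - i.
    exact: conj_imag.
  by rewrite /q; lmod_coefs R[i]; ring.
have -> : x * ustar x + ustar x * x = (2^-1)%:C *: (p * p + q * q).
  rewrite /p /q -scalerAl -scalerAr scalerA ii mulrBl !mulrBr mulrDl !mulrDr.
  by lmod_coefs R[i]; rewrite fmorphV/= rmorph_nat; field.
by apply: accZ; [rewrite invr_ge0|apply: accD; exact: acc_sqr].
Qed.

(** 1 - h (3 - h)^2 / 4 = (1 - h)^2 (4 - h) / 4, a product of commuting accretive elements. *)
Lemma acc_cubic_le1 h : sa h -> acc (1 - h) ->
  acc (1 - (4^-1)%:C *: ((3%:C *: 1 - h) * h * (3%:C *: 1 - h))).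
Proof.
move=> sah acch.
have -> : 1 - (4^-1)%:C *: ((3%:C *: 1 - h) * h * (3%:C *: 1 - h)) =
    (4^-1)%:C *: ((1 - h) * (1 - h) * (3%:C *: 1 + (1 - h))).
  rewrite !(mulrBl, mulrBr, mulrDl, mulrDr) -!(scalerAl, scalerAr).
  rewrite -?scalerAl -?scalerAr ?mul1r ?mulr1 ?mulrA.
  by lmod_coefs R[i]; rewrite fmorphV/= !rmorph_nat; field.
apply: accZ; first by rewrite invr_ge0.
have sa1h : sa (1 - h) by apply: saD; [exact: sa1|exact: saN].
apply: accM.
- exact: saM.
- by apply: saD => //; apply: saZ; exact: sa1.
- exact: acc_sqr.
- by apply: accD => //; apply: accZ => //; exact: acc1.
- move: (1 - h) => u.
  by rewrite mulrDl mulrDr mulr_algl mulr_algr mulrA.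
Qed.

(** h = (4/9) h (3 - h)^2 / 4 + h^2 (6 - h) / 9, and the last term is accretive. *)
Lemma acc_cubic_lower h (d : R) : sa h -> acc (1 - h) ->
  acc (d%:C *: 1 + (4^-1)%:C *: ((3%:C *: 1 - h) * h * (3%:C *: 1 - h))) ->
  acc ((4 / 9 * d)%:C *: 1 + h).
Proof.
move=> sah acch accd.
have [q qE] : exists q : R, q = 4 / 9 by exists (4 / 9).
rewrite -qE; have -> : (q * d)%:C *: 1 + h =
  q%:C *: (d%:C *: 1 + (4^-1)%:C *: ((3%:C *: 1 - h) * h * (3%:C *: 1 - h)))
  + (9^-1)%:C *: (h * h * (5%:C *: 1 + (1 - h))).
  rewrite (mulrDr (h * h)) !(mulrBl, mulrBr) -!(scalerAl, scalerAr).
  rewrite -?scalerAl -?scalerAr ?mul1r ?mulr1 ?mulrA.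
  by lmod_coefs R[i]; rewrite ?qE !(rmorphM, fmorphV)/= ?rmorph_nat; field.
apply: accD; first by apply: accZ => //; rewrite qE divr_ge0.
apply: accZ; first by rewrite invr_ge0.
have sa1h : sa (1 - h) by apply: saD; [exact: sa1|exact: saN].
apply: accM.
- exact: saM.
- by apply: saD => //; apply: saZ; exact: sa1.
- exact: acc_sqr.
- by apply: accD => //; apply: accZ => //; exact: acc1.
- rewrite !(mulrBl, mulrBr, mulrDl, mulrDr) -?scalerAl -?scalerAr.
  by rewrite mul1r mulr1 !mulrA.
Qed.

(* The map x |-> x(3 - x* x)/2 preserves the two hypotheses and multiplies
   the negative part of x* x by at least 9/4; the spectrum of x* x starts
   above -1 because x x* + x* x is a sum of squares. *)
Lemma acc_star_lower (n : nat) x : acc (1 - ustar x * x) ->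
  acc (1 - x * ustar x) -> acc (((4 / 9) ^+ n)%:C *: 1 + ustar x * x).
Proof.
elim: n x => [|n IHn] x acc1x acc1x'.
  have -> : ((4 / 9) ^+ 0)%:C *: 1 + ustar x * x =
      (1 - x * ustar x) + (x * ustar x + ustar x * x).
    by rewrite expr0 scale1r; lmod_coefs R[i]; ring.
  by apply: accD => //; exact: acc_sum_sqr.
have sah : sa (ustar x * x) by exact: sa_sq.
have sah' : sa (x * ustar x) by rewrite -[X in X * _]ustarK; exact: sa_sq.
rewrite exprS; apply: acc_cubic_lower => //.
pose k := 3%:C *: 1 - ustar x * x; pose k' := 3%:C *: 1 - x * ustar x.
have sak : ustar k = k.
  by rewrite /k; apply: saD; [exact/saZ/sa1|exact: saN].
(* This intertwining makes y* y and y y* the same cubic, evaluated at x* x and at x x*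
   respectively. *)
have xk : x * k = k' * x.
  by rewrite /k /k' mulrBr mulrBl -scalerAl -scalerAr mul1r mulr1 mulrA.
have kx : k * ustar x = ustar x * k'.
  by rewrite /k /k' mulrBr mulrBl -scalerAl -scalerAr mul1r mulr1 mulrA.
pose y := (2^-1)%:C *: (x * k).
have half : (2^-1)%:C * (2^-1)%:C = (4^-1)%:C :> R[i].
  by rewrite -rmorphM/=; congr (_%:C); field.
have yy : ustar y * y = (4^-1)%:C *: (k * (ustar x * x) * k).
  rewrite /y ustarZ conj_real ustarM sak -scalerAl -scalerAr scalerA half.
  by rewrite !mulrA.
have yy' : y * ustar y = (4^-1)%:C *: (k' * (x * ustar x) * k').
  rewrite /y ustarZ conj_real ustarM sak -scalerAl -scalerAr scalerA half xk.
  by rewrite kx !mulrA.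
rewrite -yy; apply: IHn; first by rewrite yy; exact: acc_cubic_le1.
by rewrite yy'; exact: acc_cubic_le1.
Qed.

(** Scaling x by 1 / c brings both products below 1, as M, N <= c <= c^2; the lower bounds -(4/9)^n
    then tend to 0. *)
Lemma acc_star x : acc (ustar x * x).
Proof.
have [M M0 xM] := ex_bnd (ustar x * x).
have [N N0 xN] := ex_bnd (x * ustar x).
pose c := M + N + 1; have c1 : 1 <= c by rewrite lerDr addr_ge0.
have c0 : 0 < c by rewrite (lt_le_trans ltr01).
pose y := (c^-1)%:C *: x.
have cc : (c^-1)%:C * (c^-1)%:C = ((c ^+ 2)^-1)%:C :> R[i].
  by rewrite -rmorphM/= -invfM expr2.
have yy : ustar y * y = ((c ^+ 2)^-1)%:C *: (ustar x * x).
  by rewrite /y ustarZ conj_real -scalerAl -scalerAr scalerA cc.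
have yy' : y * ustar y = ((c ^+ 2)^-1)%:C *: (x * ustar x).
  by rewrite /y ustarZ conj_real -scalerAl -scalerAr scalerA cc.
have acc_le1 (u : U) (L : R) : L <= c -> bnd u L ->
    acc (1 - ((c ^+ 2)^-1)%:C *: u).
  move=> Lc uL; rewrite -[X in X - _]scale1r; apply: (@bnd_acc1 _ _ _ 1).
  apply: bndW (bndZ _ uL); rewrite nmR ger0_norm ?invr_ge0 ?sqr_ge0//.
  by rewrite mulrC ler_pdivrMr ?exprn_gt0// mul1r expr2; nra.
have accy n := @acc_star_lower n y.
rewrite yy yy' in accy.
have acc_y : acc (ustar y * y).
  apply: acc_cvg => e e0.
  have q01 : 0 <= (4 / 9 : R) < 1 by apply/andP; split; lra.
  have [n small] := geometric_small q01 ler01 e0.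
  exists (((4 / 9) ^+ n)%:C *: 1 + ustar y * y).
    rewrite yy; apply: accy; apply: acc_le1; [|exact: xM| |exact: xN].
      by rewrite /c; lra.
    by rewrite /c; lra.
  have -> : ustar y * y - (((4 / 9) ^+ n)%:C *: 1 + ustar y * y) =
      (- ((4 / 9) ^+ n)%:C) *: 1 by lmod_coefs R[i]; ring.
  apply: bndW (bndZ _ (@bnd1 _ B)); rewrite nmN nmR ger0_norm ?exprn_ge0//.
  by have := small n (leqnn n); rewrite mul1r mulr1.
have -> : ustar x * x = (c ^+ 2)%:C *: (ustar y * y).
  rewrite yy scalerA -rmorphM/= divff ?scale1r//.
  by rewrite gt_eqF// exprn_gt0.
by apply: accZ acc_y; rewrite sqr_ge0.
Qed.

(** With s = |a + b|, s - a = (s - (a + b)) + b is accretive, hence so is s^2 - a^2 = (s - a)(s +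
    a), and [bnd_acc_sqr] bounds multiplication by a. *)
Lemma nm_cpos_le (a b : B) : cpos a -> cpos b -> nm a <= nm (a + b).
Proof.
pose emb (c : B) : U := (0, c).
have actE c z : act (emb c) z = cmul c z by rewrite /act/= scale0r add0r.
have embM c : emb (cmul (cstar c) c) = ustar (emb c) * emb c.
  rewrite /emb /ustar/=; congr (_, _); first by rewrite /= mulr0.
  by rewrite /= conjC0 !scale0r !add0r.
have embD c d : emb (c + d) = emb c + emb d.
  by rewrite /emb; congr (_, _); rewrite /= addr0.
move=> [c ac] [d bd]; set s := nm (a + b).
have saa : sa (emb a) by rewrite ac embM; exact: sa_sq.
have s0 : 0 <= s by exact: nm_ge0.
have acca : acc (emb a) by rewrite ac embM; exact: acc_star.
have accs : acc (s%:C *: 1 - emb a).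
  have -> : s%:C *: 1 - emb a = (s%:C *: 1 - emb (a + b)) + emb b.
    by rewrite embD; lmod_coefs R[i]; ring.
  apply: accD; last by rewrite bd embM; exact: acc_star.
  by apply: bnd_acc1 => z; rewrite actE nm_cmul.
have bnda : bnd (emb a) s.
  apply: bnd_acc_sqr => //.
  have -> : (s ^+ 2)%:C *: 1 - emb a * emb a =
      (s%:C *: 1 - emb a) * (s%:C *: 1 + emb a).
    rewrite mulrBl !mulrDr -!scalerAl -!scalerAr mul1r mulr1 scalerA mul1r.
    by lmod_coefs R[i]; rewrite ?rmorphXn/=; ring.
  apply: accM => //.
  - by apply: saD; [exact/saZ/sa1|exact: saN].
  - by apply: saD => //; exact/saZ/sa1.
  - by apply: accD => //; apply: accZ => //; exact: acc1.
  - rewrite !(mulrDl, mulrDr) -!scalerAl -!scalerAr !mul1r !mulr1 !mulNr !mulrN.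
    by lmod_coefs R[i]; ring.
(* Testing the bound on a itself gives |a|^2 = |a* a| <= s |a|. *)
have := bnda a; have [->|a0] := eqVneq a 0; first by rewrite nm0.
rewrite actE -{1}[a](congr1 snd saa : cstar a = a) nm_cstar_cmul expr2.
by rewrite ler_pM2r ?nm_gt0.
Qed.

End Positivity.

(** * Sequences and contractions *)

Section Sequences.
Variable R : realType.

Definition cvs (V : normedModType R[i]) (u : nat -> V) (l : V) :=
  forall e : R, 0 < e -> \forall n \near \oo, nm (u n - l) <= e.

Definition cauchys (V : normedModType R[i]) (u : nat -> V) :=
  forall e : R, 0 < e -> exists N, forall m n, (N <= m)%N -> (N <= n)%N ->
    nm (u m - u n) <= e.

Lemma pos_realC (e : R[i]) : 0 < e -> 0 < complex.Re e /\ e = (complex.Re e)%:C.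
Proof.
case: e => a b; rewrite ltcE/= => /andP[/eqP b0 a0]; split=> //.
by apply/eqP; rewrite eq_complex/= b0 !eqxx.
Qed.

Lemma denseP (V : normedModType R[i]) (A : set V) :
  dense A <-> forall x (e : R), 0 < e -> exists2 a, A a & nm (x - a) < e.
Proof.
split=> [dA x e e0|dA O [x Ox] oO].
  have eC0 : 0 < e%:C by rewrite ltcR.
  have [||a [Oa Aa]] := dA (ball x e%:C)°.
  - exists x; exact: nbhsx_ballx.
  - exact: open_interior.
  - exists a => //; have := interior_subset Oa.
    by rewrite -ball_normE/= nmE ltcR.
have : nbhs x O by apply: open_nbhs_nbhs.
move=> /nbhs_ballP[e /= /pos_realC[e0 eE]] xO.
have [a Aa xa] := dA x _ e0; exists a; split=> //; apply: xO.
by rewrite -ball_normE/= nmE eE ltcR.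
Qed.

Lemma cauchys_cvs (V : completeNormedModType R[i]) (u : nat -> V) :
  cauchys u -> exists l, cvs u l.
Proof.
move=> cu; have : cvgn u.
  apply/cauchy_cvgP/cauchy_ballP => _/posnumP[e]; near_simpl.
  have [e0 eE] := pos_realC (gt0 e).
  have e20 : 0 < complex.Re e%:num / 2 by rewrite divr_gt0.
  have [N uN] := cu _ e20.
  exists ([set n | (N <= n)%N], [set n | (N <= n)%N]) => /=.
    by split; exists N.
  move=> [m n] /= [Nm Nn]; rewrite -ball_normE/= nmE eE ltcR.
  by rewrite (le_lt_trans (uN _ _ Nm Nn))// ltr_pdivrMr// ltr_pMr// ltr1n.
move=> /cvg_ex[l ul]; exists l => e e0.
have := ul; move/cvgrPdist_le => /(_ e%:C).
rewrite ltcR => /(_ e0); apply: filterS => n.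
by rewrite nmE lecR nm_subC.
Qed.

Section Limits.
Variable V : normedModType R[i].
Implicit Types (u v : nat -> V) (x y l : V).

Lemma cvs_cst x : cvs (fun=> x) x.
Proof. by move=> e e0; near=> n; rewrite subrr nm0 ltW. Unshelve. all: end_near. Qed.

Lemma cvs_le u l (W : normedModType R[i]) (w : nat -> W) (m : W)
   (C : R) : 0 <= C -> cvs w m ->
  (\forall n \near \oo, nm (u n - l) <= C * nm (w n - m)) -> cvs u l.
Proof.
move=> C0 wm le_w e e0.
have := wm _ (divr_gt0 e0 (ltr_wpDl C0 ltr01)); move=> wm'.
near=> n; have le1 : nm (u n - l) <= C * nm (w n - m) by near: n.
apply: le_trans le1 _.
have le2 : nm (w n - m) <= e / (C + 1) by near: n.
by apply: le_trans (ler_wpM2l C0 le2) _; rewrite mulrC divD1_mul_le// ltW.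
Unshelve. all: end_near. Qed.

Lemma cvsD u v x y : cvs u x -> cvs v y -> cvs (fun n => u n + v n) (x + y).
Proof.
move=> ux vy e e0; have e20 : 0 < e / 2 by rewrite divr_gt0.
near=> n; rewrite opprD addrACA; apply: le_trans (nmD _ _) _.
have : nm (u n - x) <= e / 2 by near: n; exact: ux.
have : nm (v n - y) <= e / 2 by near: n; exact: vy.
lra.
Unshelve. all: end_near. Qed.

Lemma cvsZ (c : R[i]) u x : cvs u x -> cvs (fun n => c *: u n) (c *: x).
Proof.
move=> ux; apply: (cvs_le (nm_ge0 c) ux).
by near=> n; rewrite -scalerBr nmZ.
Unshelve. all: end_near. Qed.

Lemma cvsN u x : cvs u x -> cvs (fun n => - u n) (- x).
Proof. by move=> ux e /ux; apply: filterS => n; rewrite -opprD nmN. Qed.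

Lemma cvs_bound u x (f : R) : cvs u x ->
  (\forall n \near \oo, nm (u n) <= f) -> nm x <= f.
Proof.
move=> ux uf; apply/ler_addgt0Pr => e e0.
near \oo => n.
have : nm (u n) <= f by near: n.
have : nm (u n - x) <= e by near: n; exact: ux.
have := nm_le_sub x (u n); rewrite nm_subC; lra.
Unshelve. all: end_near. Qed.

Lemma cvs_unique u x y : cvs u x -> cvs u y -> x = y.
Proof.
move=> ux uy; apply/eqP; rewrite -subr_eq0; apply/eqP/nm_eq0/eqP.
rewrite eq_le nm_ge0 andbT; apply: (@cvs_bound (fun n => u n - u n)).
  exact: (cvsD ux (cvsN uy)).
by near=> n; rewrite subrr nm0.
Unshelve. all: end_near. Qed.

Lemma cvs_cauchy u x : cvs u x -> cauchys u.
Proof.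
move=> ux e e0; have [N _ uN] := ux _ (divr_gt0 e0 (ltr0n _ 2)).
exists N => m n Nm Nn; have := nm_sub_trans x (u m) (u n).
by have := uN m Nm; have := uN n Nn; rewrite /= (nm_subC (u n)); lra.
Qed.

End Limits.

(** Three comparison sequences, because the typical bound is by |x| + |S x| + |T x|; unneeded slots
    are filled with repeated or zero sequences. *)
Lemma cauchys_le (V W1 W2 W3 : normedModType R[i]) (u : nat -> V)
    (w1 : nat -> W1) (w2 : nat -> W2) (w3 : nat -> W3) (C : R) :
  0 <= C -> cauchys w1 -> cauchys w2 -> cauchys w3 ->
  (exists N, forall m n, (N <= m)%N -> (N <= n)%N ->
     nm (u m - u n) <=
     C * (nm (w1 m - w1 n) + nm (w2 m - w2 n) + nm (w3 m - w3 n))) ->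
  cauchys u.
Proof.
move=> C0 c1 c2 c3 [N le_w] e e0.
have e30 : 0 < e / 3 / (C + 1) by rewrite !divr_gt0// ltr_wpDl.
have [M1 w1M] := c1 _ e30; have [M2 w2M] := c2 _ e30; have [M3 w3M] := c3 _ e30.
exists (maxn (maxn N M1) (maxn M2 M3)) => m n; rewrite !geq_max.
move=> /andP[/andP[Nm M1m] /andP[M2m M3m]] /andP[/andP[Nn M1n] /andP[M2n M3n]].
apply: le_trans (le_w _ _ Nm Nn) _.
have := w1M _ _ M1m M1n; have := w2M _ _ M2m M2n; have := w3M _ _ M3m M3n.
have : e / 3 / (C + 1) * C <= e / 3 by rewrite divD1_mul_le// ltW// divr_gt0.
by move: C0; set d := e / 3 / (C + 1); nra.
Qed.

Lemma near_divn (C e : R) : 0 <= C -> 0 < e ->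
  \forall n \near \oo, C / n.+1%:R <= e.
Proof.
move=> C0 e0; near=> n.
rewrite ler_pdivrMr// mulrC -ler_pdivrMr//.
have := archi_boundP (divr_ge0 C0 (ltW e0)) => /ltW/le_trans; apply.
by rewrite ler_nat ltnW// ltnS; near: n; exact: nbhs_infty_ge.
Unshelve. all: end_near. Qed.

Lemma contraction_fixpoint (V : completeNormedModType R[i]) (f : V -> V)
    (q : R) : 0 <= q < 1 ->
  (forall x y, nm (f x - f y) <= q * nm (x - y)) -> exists x, f x = x.
Proof.
move=> q01 fq; have /andP[q0 q1] := q01.
pose u n := iter n f 0; pose d := nm (f 0).
have step n : nm (u n.+1 - u n) <= q ^+ n * d.
  elim: n => [|n IHn]; first by rewrite /u/= subr0 expr0 mul1r.
  by rewrite exprS -mulrA (le_trans (fq _ _))// ler_wpM2l.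
have q1' : 0 < 1 - q by rewrite subr_gt0.
have dist m n : nm (u (n + m)%N - u n) * (1 - q) <= d * q ^+ n.
  elim: m n => [|m IHm] n.
    by rewrite addn0 subrr nm0 mul0r mulr_ge0 ?nm_ge0 ?exprn_ge0.
  have := IHm n.+1; rewrite addSnnS exprS => le1.
  have := nm_sub_trans (u n.+1) (u (n + m.+1)%N) (u n).
  have := step n; rewrite -(ler_pM2r q1') => le2.
  rewrite -(ler_pM2r q1') => le3; apply: le_trans le3 _.
  have := lerD le1 le2; rewrite mulrDl => /le_trans; apply.
  by rewrite le_eqVlt; apply/orP; left; apply/eqP; ring.
have d0 : 0 <= d / (1 - q) by rewrite divr_ge0 ?nm_ge0 ?ltW.
have cu : cauchys u.
  move=> e e0; have [N small] := geometric_small q01 d0 (divr_gt0 e0 (ltr0n _ 2)).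
  have le_N m : (N <= m)%N -> nm (u m - u N) <= e / 2.
    move=> Nm; have := dist (m - N)%N N; rewrite subnKC// -ler_pdivlMr//.
    by move=> /le_trans; apply; have := small N (leqnn N); rewrite mulrAC.
  exists N => m n Nm Nn; have := nm_sub_trans (u N) (u m) (u n).
  by have := le_N _ Nm; have := le_N _ Nn; rewrite (nm_subC (u n)); lra.
have [x ux] := cauchys_cvs cu; exists x.
apply: (@cvs_unique _ (fun n => u n.+1)) => e e0.
  have := ux _ e0; apply: filterS => n; apply: le_trans.
  by rewrite (le_trans (fq _ _))// ler_piMl ?nm_ge0// ltW.
have [N _ uN] := ux _ e0; exists N => // n /= Nn.
by apply: (uN n.+1); rewrite /= (leq_trans Nn).
Qed.

End Sequences.

(** * Symmetric operators on Hilbert modules *)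

Section InnerProduct.
Variables (R : realType) (B : cstarAlgType R) (E : hilbertModType B).
Implicit Types x y z u v : E.

Lemma innerDl x y z : inner (x + y) z = inner x z + inner y z.
Proof. by rewrite !(innerC z) innerD cstarD. Qed.

Lemma innerZl (c : R[i]) x y : inner (c *: x) y = (c^*)%R *: inner x y.
Proof. by rewrite !(innerC y) innerZ cstarZ. Qed.

Lemma innerNr x y : inner x (- y) = - inner x y.
Proof. by rewrite -scaleN1r innerZ scaleN1r. Qed.

Lemma innerNl x y : inner (- x) y = - inner x y.
Proof. by rewrite !(innerC y) innerNr cstarN. Qed.

Lemma inner0l x : inner 0 x = 0.
Proof. by rewrite -(subrr 0) innerDl innerNl subrr. Qed.

Lemma inner0r x : inner x 0 = 0.
Proof. by rewrite -(subrr 0) innerD innerNr subrr. Qed.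

Definition innerE :=
  (@innerD R B E, innerDl, @innerZ R B E, innerZl, innerNr, innerNl).

Lemma nm_inner x : nm (inner x x) = nm x ^+ 2.
Proof. by apply: complexI; rewrite rmorphXn/= -!nmE norm_inner. Qed.

Lemma inner_eq0 x : inner x x = 0 -> x = 0.
Proof.
move=> x0; apply/nm_eq0/eqP; rewrite -sqrf_eq0 -nm_inner x0.
by rewrite nm0.
Qed.

(* By polarisation; the constant is immaterial. *)
Lemma inner_bound x y : nm (inner x y) <= 4 * (nm x * nm y).
Proof.
have bound1 u v : nm u = 1 -> nm v = 1 -> nm (inner u v) <= 4.
  move=> u1 v1; pose i : R[i] := 0 +i* 1.
  have i1 : nm i = 1 by rewrite nmI normr1.
  have le4 c : nm c = 1 -> nm (inner (u + c *: v) (u + c *: v)) <= 4.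
    move=> c1; rewrite nm_inner; have := nmD u (c *: v).
    by rewrite nmZ c1 u1 v1; have := nm_ge0 (u + c *: v); nra.
  have -> : inner u v = (4^-1)%:C *:
     (inner (u + 1 *: v) (u + 1 *: v) - inner (u + (-1) *: v) (u + (-1) *: v)
     - i *: (inner (u + i *: v) (u + i *: v)
             - inner (u + (- i) *: v) (u + (- i) *: v))).
    have ic : (i^*)%R = - i by exact: conj_imag.
    have icN : ((- i)^*)%R = i by rewrite rmorphN /= ic opprK.
    have cN1 : ((-1 : R[i])^*)%R = -1 by rewrite rmorphN rmorph1.
    rewrite !innerE !(icN, ic, cN1, conjC1).
    have ii : i * i = -1 by rewrite imag_sqr expr1n.
    by lmod_coefs R[i]; rewrite fmorphV/= rmorph_nat; field: ii.
  rewrite nmZ nmR ger0_norm ?invr_ge0//.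
  have := nmB (inner (u + 1 *: v) (u + 1 *: v)
     - inner (u + (-1) *: v) (u + (-1) *: v))
    (i *: (inner (u + i *: v) (u + i *: v)
             - inner (u + (- i) *: v) (u + (- i) *: v))).
  rewrite nmZ i1 mul1r.
  have := nmB (inner (u + 1 *: v) (u + 1 *: v))
    (inner (u + (-1) *: v) (u + (-1) *: v)).
  have := nmB (inner (u + i *: v) (u + i *: v))
    (inner (u + (- i) *: v) (u + (- i) *: v)).
  have := le4 1; have := le4 (-1); have := le4 i; have := le4 (- i).
  rewrite !nmN i1 /nm normr1 /= => /(_ erefl) ? /(_ erefl) ? /(_ erefl) ?.
  by move=> /(_ erefl) ?; lra.
have [->|x0] := eqVneq x 0; first by rewrite inner0l !nm0 mul0r mulr0.
have [->|y0] := eqVneq y 0; first by rewrite inner0r !nm0 !mulr0.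
have xn := nm_gt0 x0; have yn := nm_gt0 y0.
have n1 u : 0 < nm u -> nm (((nm u)^-1)%:C *: u) = 1.
  by move=> u0; rewrite nmZ nmR gtr0_norm ?invr_gt0// mulVf ?gt_eqF.
have := bound1 _ _ (n1 _ xn) (n1 _ yn).
rewrite innerZ innerZl conj_real !nmZ !nmR !gtr0_norm ?invr_gt0//.
by rewrite mulrA -invfM mulrC ler_pdivrMr ?mulr_gt0// [nm y * _]mulrC.
Qed.

(** Both |x + y|^2 and |x - y|^2 equal |<x,x> + <y,y>|, and 2 x and 2 y are the sum and the
    difference of x + y and x - y. No order on B is involved. *)
Lemma nm_skew x y : inner x y + inner y x = 0 ->
  [/\ nm (x - y) = nm (x + y), nm x <= nm (x + y) & nm y <= nm (x + y)].
Proof.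
move=> xy; have eq_nm : nm (x - y) = nm (x + y).
  have : nm (x - y) ^+ 2 = nm (x + y) ^+ 2.
    rewrite -!nm_inner !innerE.
    suff -> : inner x y = - inner y x.
      by rewrite opprK; congr nm; lmod_coefs R[i]; ring.
    by apply/eqP; rewrite -addr_eq0 xy.
  by move/eqP; rewrite eqrXn2 ?nm_ge0// => /eqP.
have twice z : nm (2%:C *: z) = 2 * nm z by rewrite nmZ nmR ger0_norm.
split=> //.
  have := nmD (x + y) (x - y).
  have -> : x + y + (x - y) = 2%:C *: x.
    by lmod_coefs R[i]; rewrite ?rmorph_nat; ring.
  by rewrite twice eq_nm; lra.
have := nmB (x + y) (x - y).
have -> : x + y - (x - y) = 2%:C *: y.
  by lmod_coefs R[i]; rewrite ?rmorph_nat; ring.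
by rewrite twice eq_nm; lra.
Qed.

End InnerProduct.

Section Operators.
Variables (R : realType) (B : cstarAlgType R) (E : hilbertModType B).
Implicit Types (S T : operator E) (x y z : E) (l : R[i]).

Lemma domD S x y : dom S x -> dom S y -> dom S (x + y).
Proof. exact: (submodD (dom_submod S)). Qed.

Lemma domZ S (c : R[i]) x : dom S x -> dom S (c *: x).
Proof. exact: (submodZ (dom_submod S)). Qed.

Lemma domN S x : dom S x -> dom S (- x).
Proof. by rewrite -scaleN1r; exact: domZ. Qed.

Lemma domB S x y : dom S x -> dom S y -> dom S (x - y).
Proof. by move=> ? /domN; exact: domD. Qed.

Lemma appN S x : dom S x -> S (- x) = - S x.
Proof. by move=> Sx; rewrite -scaleN1r appZ// scaleN1r. Qed.

Lemma appB S x y : dom S x -> dom S y -> S (x - y) = S x - S y.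
Proof. by move=> Sx Sy; rewrite appD ?appN//; exact: domN. Qed.

Definition symmetric_op S := forall x y, dom S x -> dom S y ->
  inner (S x) y = inner x (S y).

Definition surj_shift S l := forall y, exists2 x, dom S x & S x + l *: x = y.

Definition closed_op S := forall (u : nat -> E) x y, (forall n, dom S (u n)) ->
  cvs u x -> cvs (fun n => S (u n)) y -> dom S x /\ S x = y.

Lemma self_adjoint_symmetric S : self_adjoint S -> symmetric_op S.
Proof. by move=> [_ saS] x y Sx Sy; apply: (saS y (S y)).2. Qed.

Lemma self_adjoint_closed S : self_adjoint S -> closed_op S.
Proof.
move=> saS u x y Su ux Suy; suff /saS.2[] : adjoint_graph S x y by [].
have symS := self_adjoint_symmetric saS.
move=> w Sw; apply/eqP; rewrite -subr_eq0; apply/eqP/nm_eq0/eqP.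
rewrite eq_le nm_ge0 andbT; apply/ler_addgt0Pr => e e0; rewrite add0r.
pose C := 4 * (nm (S w) + nm w + 1).
have C0 : 0 < C by have := nm_ge0 (S w); have := nm_ge0 w; rewrite /C; lra.
have eC : 0 < e / C by rewrite divr_gt0.
near \oo => n.
have le1 : nm (u n - x) <= e / C by near: n; exact: ux.
have le2 : nm (S (u n) - y) <= e / C by near: n; exact: Suy.
have -> : inner (S w) x - inner w y =
    inner w (S (u n) - y) - inner (S w) (u n - x).
  by rewrite !innerE (symS _ _ Sw (Su n)); lmod_coefs R[i]; ring.
apply: le_trans (nmB _ _) _.
have := inner_bound w (S (u n) - y); have := inner_bound (S w) (u n - x).
have := ler_wpM2l (nm_ge0 w) le2; have := ler_wpM2l (nm_ge0 (S w)) le1.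
have := divfK (lt0r_neq0 C0) e; move: (eC); set t := e / C.
rewrite /C; nra.
Unshelve. all: end_near. Qed.

(** [nm_skew] applied to S x + (Re l) x and i (Im l) x. *)
Lemma shift_bound S l x : symmetric_op S -> dom S x ->
  nm (S x + (complex.Re l)%:C *: x) <= nm (S x + l *: x) /\
  `|complex.Im l| * nm x <= nm (S x + l *: x).
Proof.
move=> symS Sx; case: l => a b /=.
have [|_ le1 le2] := @nm_skew _ _ _ (S x + a%:C *: x) ((0 +i* b) *: x).
  rewrite !innerE conj_real conj_imag symS//.
  by lmod_coefs R[i]; ring.
have e : S x + a%:C *: x + (0 +i* b) *: x = S x + (a +i* b) *: x.
  rewrite -addrA -scalerDl; congr (_ + _ *: _).
  by apply/eqP; rewrite eq_complex/= addr0 add0r !eqxx.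
by rewrite -e; split=> //; move: le2; rewrite nmZ nmI.
Qed.

Lemma shift_inj S l x y : symmetric_op S -> complex.Im l != 0 ->
  dom S x -> dom S y -> S x + l *: x = S y + l *: y -> x = y.
Proof.
move=> symS l0 Sx Sy eq_l; apply/eqP; rewrite -subr_eq0; apply/eqP/nm_eq0/eqP.
have [_] := shift_bound l symS (domB Sx Sy).
have -> : S (x - y) + l *: (x - y) = 0.
  by rewrite appB// scalerBr addrACA -opprD eq_l subrr.
rewrite nm0 pmulr_rle0 ?normr_gt0// => le0.
by rewrite eq_le le0 nm_ge0.
Qed.

(** With Q = (S + l)^-1, x = Q z solves the shifted equation when z = y - (l' - l) Q z, a
    contraction because |Q| <= 1 / |Im l|. *)
Lemma surj_perturb S l l' : symmetric_op S -> surj_shift S l ->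
  nm (l' - l) < `|complex.Im l| -> surj_shift S l'.
Proof.
move=> symS surjS lt_l y.
have b0 : 0 < `|complex.Im l| by rewrite (le_lt_trans (nm_ge0 _) lt_l).
have /choice[Q QP] : forall z, exists x, dom S x /\ S x + l *: x = z.
  by move=> z; have [x] := surjS z; exists x.
have q01 : 0 <= nm (l' - l) / `|complex.Im l| < 1.
  by rewrite divr_ge0 ?nm_ge0//= ltr_pdivrMr// mul1r.
have [|z zP] := @contraction_fixpoint _ _ (fun z => y - (l' - l) *: Q z) _ q01.
  move=> z w; have [Sz Ez] := QP z; have [Sw Ew] := QP w.
  have [_] := shift_bound l symS (domB Sz Sw).
  have -> : S (Q z - Q w) + l *: (Q z - Q w) = z - w.
    transitivity (S (Q z) + l *: Q z - (S (Q w) + l *: Q w)).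
      by rewrite appB//; lmod_coefs R[i]; ring.
    by rewrite Ez Ew.
  move=> le1.
  have -> : y - (l' - l) *: Q z - (y - (l' - l) *: Q w) =
      (l' - l) *: (Q w - Q z) by lmod_coefs R[i]; ring.
  rewrite nmZ (nm_subC (Q w)) -mulrA ler_wpM2l ?nm_ge0//.
  by rewrite mulrC ler_pdivlMr// mulrC.
have [Sz Ez] := QP z; exists (Q z) => //.
have -> : y = z + (l' - l) *: Q z by rewrite -{1}zP subrK.
by rewrite -[X in _ = X + _]Ez; lmod_coefs R[i]; ring.
Qed.

(* Discs of radius |Im l|: go up along the imaginary direction until the disc
   contains l'. *)
Lemma surj_walk S l l' : symmetric_op S -> surj_shift S l ->
  0 < complex.Im l * complex.Im l' -> surj_shift S l'.
Proof.
case: l => a b; case: l' => a' b' /= symS surjS bb.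
have b0 : b != 0 by apply: contraTneq bb => ->; rewrite mul0r ltxx.
have up n : surj_shift S (a +i* (b * (1 + n%:R / 2))).
  elim: n => [|n IHn]; first by rewrite mul0r addr0 mulr1.
  apply: (surj_perturb symS IHn).
  have -> : a +i* (b * (1 + n.+1%:R / 2)) - (a +i* (b * (1 + n%:R / 2))) =
      0 +i* (b / 2).
    by apply/eqP; rewrite eq_complex/= subrr eqxx/= -natr1; apply/eqP; field.
  rewrite nmI /= !normrM ltr_pM2l ?normr_gt0//.
  have n0 : 0 <= n%:R / 2 :> R by rewrite divr_ge0.
  by rewrite !ger0_norm ?invr_ge0 ?addr_ge0//; lra.
(* With s = b (1 + n / 2), the condition (a' - a)^2 + (b' - s)^2 < s^2 amounts to K < n + 2. *)
pose K := ((a' - a) ^+ 2 + b' ^+ 2) / (b * b').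
have K0 : 0 <= K by rewrite divr_ge0 ?addr_ge0 ?sqr_ge0// ltW.
have := archi_boundP K0; set n := Num.bound K => Kn.
apply: (surj_perturb symS (up n)); set s := b * _.
rewrite -ltr_sqr ?nnegrE ?nm_ge0// real_normK ?num_real//.
have -> : nm (a' +i* b' - (a +i* s)) ^+ 2 = (a' - a) ^+ 2 + (b' - s) ^+ 2.
  apply: complexI; rewrite rmorphXn/= -nmE -add_Re2_Im2/=.
  by rewrite !rmorphD !rmorphXn.
have : K * (b * b') < n%:R * (b * b') by rewrite ltr_pM2r.
rewrite divfK ?gt_eqF// /s /=; nra.
Qed.

Lemma surj_dense S l : surj_shift S l -> dense (shift_range S l).
Proof.
move=> surjS; apply/denseP => y e e0; have [x Sx xy] := surjS y.
by exists y; [exists x|rewrite subrr nm0].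
Qed.

Lemma dense_surj S l : symmetric_op S -> closed_op S -> complex.Im l != 0 ->
  dense (shift_range S l) -> surj_shift S l.
Proof.
move=> symS clS l0 /denseP dS y.
have /choice[u uP] : forall n : nat, exists x, dom S x /\
    nm (y - (S x + l *: x)) < n.+1%:R^-1.
  move=> n; have [|_ [x Sx ->] lt_n] := dS y n.+1%:R^-1; first by rewrite invr_gt0.
  by exists x.
pose f n := S (u n) + l *: u n.
have fy : cvs f y.
  move=> e e0; have := near_divn ler01 e0; apply: filterS => n.
  by rewrite mul1r => /(le_trans _); apply; rewrite nm_subC ltW// (uP n).2.
have b0 : 0 < `|complex.Im l| by rewrite normr_gt0.
have cu : cauchys u.
  have cf := cvs_cauchy fy.
  apply: (@cauchys_le _ _ _ _ _ u f f f (`|complex.Im l|^-1)); rewrite ?invr_ge0//.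
  exists 0%N => m n _ _; have [Sm _] := uP m; have [Sn _] := uP n.
  have [_] := shift_bound l symS (domB Sm Sn).
  have -> : S (u m - u n) + l *: (u m - u n) = f m - f n.
    by rewrite appB// /f; lmod_coefs R[i]; ring.
  have := nm_ge0 (f m - f n); rewrite mulrC -ler_pdivlMr// [_ / _]mulrC.
  by move=> f0 /le_trans; apply; rewrite ler_wpM2l ?invr_ge0//; lra.
have [x ux] := cauchys_cvs cu.
have Sux : cvs (fun n => S (u n)) (y - l *: x).
  move=> e e0; have := cvsD fy (cvsN (cvsZ l ux)) e0.
  by apply: filterS => n; rewrite /f addrK.
have [Sx SxE] := clS u x _ (fun n => (uP n).1) ux Sux.
by exists x => //; rewrite SxE subrK.
Qed.

Lemma self_adjoint_surj S l : self_adjoint S -> regular S ->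
  complex.Im l != 0 -> surj_shift S l.
Proof.
move=> saS [l0 [im0 d1 d2]] iml.
have symS := self_adjoint_symmetric saS; have clS := self_adjoint_closed saS.
have [lt0|le0] := ltP 0 (complex.Im l0 * complex.Im l).
  exact: surj_walk (dense_surj symS clS im0 d1) lt0.
have im0' : complex.Im (- l0) != 0 by case: (l0) im0 => a b /=; rewrite oppr_eq0.
apply: surj_walk (dense_surj symS clS im0' d2) _ => //.
move: le0; rewrite le_eqVlt mulf_eq0 (negPf im0) (negPf iml)/=.
by case: (l0) => a b /=; rewrite mulNr oppr_gt0.
Qed.

(** If (y, z) is in the adjoint graph, surjectivity of S + i gives w in the domain with (S + i) w =
    z + i y; then y - w is orthogonal to the range of S - i, which is everything. *)
Lemma symmetric_surj_self_adjoint S l : symmetric_op S -> dense (dom S) ->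
  complex.Im l != 0 -> surj_shift S l -> surj_shift S (- l) ->
  self_adjoint S /\ regular S.
Proof.
move=> symS dS iml s1 s2.
have [a b] : surj_shift S (0 +i* 1) /\ surj_shift S (- (0 +i* 1)).
  case: l iml s1 s2 => a b /= b0 s1 s2.
  have [bpos|bneg] := ltP 0 b.
    split; first by apply: surj_walk s1 _ => //=; rewrite mulr1.
    by apply: surj_walk s2 _ => //=; rewrite mulrNN mulr1.
  have {}bneg : b < 0 by rewrite lt_neqAle b0.
  split; first by apply: surj_walk s2 _ => //=; rewrite mulr1 oppr_gt0.
  by apply: surj_walk s1 _ => //=; rewrite mulrN mulr1 oppr_gt0.
split; last first.
  by exists (0 +i* 1); split; [rewrite /= oner_neq0|exact: surj_dense..].
split=> // y z; split; last by move=> [Sy ->] x Sx; exact: symS.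
move=> yz; pose i : R[i] := 0 +i* 1.
have [w Sw wE] := a (z + i *: y).
suff yw : y = w.
  rewrite yw in wE *; split => //; apply: (addIr (i *: w)).
  by rewrite wE.
have [x Sx xE] := b (y - w).
apply/eqP; rewrite -subr_eq0; apply/eqP/inner_eq0.
rewrite -{1}xE innerDl innerZl conj_imagN -/i.
have -> : inner (S x) (y - w) = inner x z - inner x (S w).
  by rewrite innerD innerNr yz// symS.
have -> : z = S w + i *: w - i *: y by rewrite wE addrK.
by rewrite !innerE; lmod_coefs R[i]; ring.
Qed.

End Operators.

(** * Resolvents and weak anticommutation *)

(** Stated through conjugation, the form in which it rewrites inside inner products. *)
Definition imaginary (R : realType) (l : R[i]) : Prop :=
  (l^*)%R = - l /\ l != 0.

Section Imaginary.
Variable R : realType.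
Implicit Types l : R[i].

Lemma imaginary_Re l : imaginary l -> complex.Re l = 0.
Proof.
move=> [+ _]; case: l => a b /eqP; rewrite conj_complexE eq_complex/=.
by move=> /andP[/eqP a0 _]; lra.
Qed.

Lemma imaginary_nm l : imaginary l -> nm l = `|complex.Im l|.
Proof. by move=> /imaginary_Re; case: l => a b /= ->; rewrite nmI. Qed.

Lemma imaginary_gt0 l : imaginary l -> 0 < nm l.
Proof. by move=> [_ /nm_gt0]. Qed.

Lemma imaginary_Im l : imaginary l -> complex.Im l != 0.
Proof. by move=> il; rewrite -normr_gt0 -imaginary_nm// imaginary_gt0. Qed.

Lemma imaginaryN l : imaginary l -> imaginary (- l).
Proof. by move=> [lc l0]; split; rewrite ?oppr_eq0// rmorphN/= lc. Qed.

Lemma imaginaryZ (r : R) l : 0 < r -> imaginary l -> imaginary (r%:C * l).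
Proof.
move=> r0 [lc l0]; split; first by rewrite rmorphM/= lc conj_real mulrN.
by rewrite mulf_neq0// fmorph_eq0 gt_eqF.
Qed.

Lemma imaginaryV l : imaginary l -> (l^-1^*)%R = - l^-1.
Proof. by move=> [lc _]; rewrite fmorphV/= lc invrN. Qed.

Definition diverging (L : nat -> R[i]) :=
  forall n, imaginary (L n) /\ n.+1%:R <= nm (L n).

Lemma diverging_ge (L : nat -> R[i]) (r : R) : diverging L ->
  \forall n \near \oo, r <= nm (L n).
Proof.
move=> LP; near=> n; apply: le_trans (LP n).2.
have : Num.max r 0 / n.+1%:R <= 1.
  by near: n; apply: near_divn => //; rewrite le_max lexx orbT.
by rewrite ler_pdivrMr// mul1r ge_max => /andP[].
Unshelve. all: end_near. Qed.

Lemma divergingN (L : nat -> R[i]) : diverging L -> diverging (fun n => - L n).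
Proof.
by move=> LP n; have [? ?] := LP n; split; [exact: imaginaryN|rewrite nmN].
Qed.

Lemma diverging_imag : diverging (fun n => 0 +i* n.+1%:R).
Proof.
move=> n; split; last by rewrite nmI ger0_norm.
split; first exact: conj_imag.
by rewrite eq_complex/= eqxx/= pnatr_eq0.
Qed.

End Imaginary.

Section Resolvents.
Variables (R : realType) (B : cstarAlgType R) (E : hilbertModType B).
Implicit Types (S T : operator E) (x y z : E) (l m : R[i]).

(* l (S + l)^-1 y, which tends to y as |l| grows. *)
Definition yos S l y : E :=
  xget 0 [set x | dom S x /\ S x + l *: x = l *: y].

(** The consequence of self-adjointness and regularity that resolvents need; it is used for S, for T
    and later for S + T. *)
Definition nonreal_surj S :=
  symmetric_op S /\ forall l, complex.Im l != 0 -> surj_shift S l.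

Section Yosida.
Variable S : operator E.
Hypothesis surjS : nonreal_surj S.
Let symS := surjS.1.

Lemma yos_spec l y : imaginary l ->
  dom S (yos S l y) /\ S (yos S l y) + l *: yos S l y = l *: y.
Proof.
move=> /imaginary_Im/surjS.2/(_ (l *: y))[x Sx xy]; rewrite /yos.
by case: (xgetPex 0 (ex_intro [set x | dom S x /\ S x + l *: x = l *: y] x _)).
Qed.

Lemma yos_dom l y : imaginary l -> dom S (yos S l y).
Proof. by move=> /yos_spec-/(_ y)[]. Qed.

Lemma op_yos l y : imaginary l -> S (yos S l y) = l *: (y - yos S l y).
Proof. by move=> /yos_spec-/(_ y)[_ xE]; rewrite scalerBr -xE addrK. Qed.

Lemma yosP l x y : imaginary l -> dom S x -> S x + l *: x = l *: y ->
  x = yos S l y.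
Proof.
move=> il Sx xE; apply: (shift_inj symS (imaginary_Im il)) => //.
  exact: yos_dom.
by rewrite xE op_yos// scalerBr subrK.
Qed.

Lemma yosD l x y : imaginary l -> yos S l (x + y) = yos S l x + yos S l y.
Proof.
move=> il; apply/esym/yosP => //; first by apply: domD; exact: yos_dom.
rewrite appD ?op_yos//; try exact: yos_dom.
by lmod_coefs R[i]; ring.
Qed.

Lemma yosZ l (c : R[i]) x : imaginary l -> yos S l (c *: x) = c *: yos S l x.
Proof.
move=> il; apply/esym/yosP => //; first by apply: domZ; exact: yos_dom.
rewrite appZ ?op_yos//; try exact: yos_dom.
by lmod_coefs R[i]; ring.
Qed.

Lemma yosN l x : imaginary l -> yos S l (- x) = - yos S l x.
Proof. by move=> il; rewrite -scaleN1r yosZ// scaleN1r. Qed.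

Lemma yosB l x y : imaginary l -> yos S l (x - y) = yos S l x - yos S l y.
Proof. by move=> il; rewrite yosD// yosN. Qed.

Lemma op_yos_bound l y : imaginary l -> nm (S (yos S l y)) <= nm l * nm y.
Proof.
move=> il; have Sy := yos_dom y il; have [le1 _] := shift_bound l symS Sy.
move: le1; rewrite (imaginary_Re il) scale0r addr0 => /le_trans; apply.
by rewrite op_yos// scalerBr subrK nmZ.
Qed.

Lemma yos_bound l y : imaginary l -> nm (yos S l y) <= nm y.
Proof.
move=> il; have Sy := yos_dom y il; have [_] := shift_bound l symS Sy.
rewrite -imaginary_nm// op_yos// scalerBr subrK (nmZ l y).
by rewrite ler_pM2l ?imaginary_gt0.
Qed.

Lemma yos_comm l y : imaginary l -> dom S y -> S (yos S l y) = yos S l (S y).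
Proof.
move=> il Sy; have Sx := yos_dom y il; apply: yosP => //.
  by rewrite op_yos//; apply/domZ/domB.
rewrite {1}(op_yos _ il) appZ ?appB//; last exact: domB.
by lmod_coefs R[i]; ring.
Qed.

(** y - J_l y = l^-1 S J_l y = l^-1 J_l S y. *)
Lemma yos_near l y : imaginary l -> dom S y ->
  nm (y - yos S l y) <= nm (S y) / nm l.
Proof.
move=> il Sy; have := yos_bound (S y) il.
by rewrite -yos_comm// op_yos// nmZ ler_pdivlMr ?imaginary_gt0// mulrC.
Qed.

Lemma yos_yos l m y : imaginary l -> imaginary m ->
  yos S l (yos S m y) = yos S m (yos S l y).
Proof.
move=> il im; apply/esym/yosP => //; first exact: yos_dom.
rewrite yos_comm//; last exact: yos_dom.
by rewrite op_yos// -yosZ// -yosD// scalerBr subrK yosZ.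
Qed.

Lemma yos_cvs (L : nat -> R[i]) y : dense (dom S) ->
  diverging L -> cvs (fun n => yos S (L n) y) y.
Proof.
move=> /denseP dS LP e e0.
have e30 : 0 < e / 3 by rewrite divr_gt0.
have [a Sa ya] := dS y _ e30.
near=> n; have [iL nL] := LP n.
have := yos_bound (y - a) iL; rewrite yosB// => le1.
have : nm (a - yos S (L n) a) <= e / 3.
  apply: le_trans (yos_near iL Sa) _.
  have : nm (S a) / n.+1%:R <= e / 3 by near: n; exact: near_divn (nm_ge0 _) e30.
  by apply: le_trans; rewrite ler_wpM2l ?nm_ge0// lef_pV2 ?posrE ?imaginary_gt0.
have -> : yos S (L n) y - y =
    (yos S (L n) y - yos S (L n) a) - (a - yos S (L n) a) + (a - y).
  by lmod_coefs R[i]; ring.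
have := nmD ((yos S (L n) y - yos S (L n) a) - (a - yos S (L n) a)) (a - y).
have := nmB (yos S (L n) y - yos S (L n) a) (a - yos S (L n) a).
by rewrite (nm_subC a y); lra.
Unshelve. all: end_near. Qed.

Lemma yos_cvs_seq (L : nat -> R[i]) (u : nat -> E) y : dense (dom S) ->
  diverging L -> cvs u y ->
  cvs (fun n => yos S (L n) (u n)) y.
Proof.
move=> dS LP uy e e0; have e20 : 0 < e / 2 by rewrite divr_gt0.
near=> n; have [iL nL] := LP n.
have := nm_sub_trans (yos S (L n) y) (yos S (L n) (u n)) y.
rewrite -yosB//; have := yos_bound (u n - y) iL.
have : nm (u n - y) <= e / 2 by near: n; exact: uy.
have : nm (yos S (L n) y - y) <= e / 2 by near: n; exact: yos_cvs.
lra.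
Unshelve. all: end_near. Qed.

End Yosida.

Lemma self_adjoint_nonreal_surj S : self_adjoint S -> regular S ->
  nonreal_surj S.
Proof.
move=> saS regS; split; first exact: self_adjoint_symmetric.
by move=> l; exact: self_adjoint_surj.
Qed.

End Resolvents.

(** * Commuting T past the resolvents of S *)

Section Anticommutator.
Variables (R : realType) (B : cstarAlgType R) (E : hilbertModType B).
Variables (S T : operator E).
Hypotheses (surjS : nonreal_surj S) (surjT : nonreal_surj T).
Hypotheses (clS : closed_op S) (clT : closed_op T).
Implicit Types (x y e v : E) (l : R[i]).

Local Notation A := (anticomm S T).
Local Notation F := (Fdom S T).
Local Notation J := (yos S).

Lemma FdomD x y : F x -> F y -> F (x + y).
Proof.
move=> [? ? ? ?] [? ? ? ?]; split; rewrite ?appD//; exact: domD.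
Qed.

Lemma FdomZ (c : R[i]) x : F x -> F (c *: x).
Proof. by move=> [? ? ? ?]; split; rewrite ?appZ//; exact: domZ. Qed.

Lemma FdomB x y : F x -> F y -> F (x - y).
Proof.
by move=> Fx Fy; rewrite -scaleN1r; apply: FdomD => //; exact: FdomZ.
Qed.

Lemma anticommD x y : F x -> F y -> A (x + y) = A x + A y.
Proof.
move=> [? ? ? ?] [? ? ? ?]; rewrite /anticomm !appD//.
by lmod_coefs R[i]; ring.
Qed.

Lemma anticommZ (c : R[i]) x : F x -> A (c *: x) = c *: A x.
Proof. by move=> [? ? ? ?]; rewrite /anticomm !appZ// scalerDr. Qed.

Lemma anticommB x y : F x -> F y -> A (x - y) = A x - A y.
Proof.
move=> Fx Fy; rewrite -scaleN1r anticommD//; last exact: FdomZ.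
by rewrite anticommZ// scaleN1r.
Qed.

(** [nm_cpos_le] turns the inequality in B into one of norms. The summand 1 in c ensures c <= c^2,
    which allows the square root to be taken. *)
Lemma wac_anticomm_bound : weakly_anticommuting S T -> exists2 c : R, 1 <= c &
  forall x, F x -> nm (A x) <= c * (nm x + nm (S x) + nm (T x)).
Proof.
move=> [[C0 [C1 [C2 [C00 C10 C20 bound]]]] _].
exists (1 + C0 + C1 + C2); first by lra.
move=> x Fx; have := bound x Fx.
set rhs := (X in cle _ X) => /(nm_cpos_le (inner_ge0 (A x))).
rewrite subrKC nm_inner => le1.
have le2 : nm rhs <= C0 * nm x ^+ 2 + C1 * nm (S x) ^+ 2 + C2 * nm (T x) ^+ 2.
  have nmC (C : R) z : 0 < C -> nm (C%:C *: inner z z) = C * nm z ^+ 2.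
    by move=> C_gt0; rewrite nmZ nmR gtr0_norm// nm_inner.
  rewrite -!nmC//; apply: le_trans (nmD _ _) _; rewrite lerD2r; exact: nmD.
rewrite -ler_sqr ?nnegrE ?mulr_ge0 ?addr_ge0 ?nm_ge0//; try lra.
apply: le_trans le1 (le_trans le2 _).
move: (nm_ge0 x) (nm_ge0 (S x)) (nm_ge0 (T x)).
move: (nm x) (nm (S x)) (nm (T x)) => a b d a0 b0 d0.
have sq : a ^+ 2 + b ^+ 2 + d ^+ 2 <= (a + b + d) ^+ 2 by nra.
have [a2 b2 d2] := And3 (sqr_ge0 a) (sqr_ge0 b) (sqr_ge0 d).
pose c := 1 + C0 + C1 + C2; have c1 : 1 <= c by rewrite /c; lra.
rewrite exprMn -/c; apply: (@le_trans _ _ (c * (a ^+ 2 + b ^+ 2 + d ^+ 2))).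
  by rewrite /c; nra.
apply: ler_pM => //; [lra|exact: addr_ge0 (addr_ge0 a2 b2) d2|].
by rewrite expr2; nra.
Qed.

(** For v = J_l e, S v = l (e - v) gives T S v = l (T e - T v), hence (S - l) T v = [S,T] v - l T
    e. *)
Lemma op_yos_anticomm l e : imaginary l -> dom T e -> F (J l e) ->
  T (J l e) = J (- l) (T e - l^-1 *: A (J l e)).
Proof.
move=> il Te [Sv Tv TSv STv]; have [_ l0] := il.
apply: (yosP surjS) => //; first exact: imaginaryN.
have TSvE : T (S (J l e)) = l *: (T e - T (J l e)).
  by rewrite op_yos// appZ ?appB//; exact: domB.
rewrite /anticomm TSvE; lmod_coefs R[i]; field; exact: l0.
Qed.

Section Bounds.
Variable c : R.
Hypothesis c1 : 1 <= c.
Hypothesis bound_A :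
  forall x, F x -> nm (A x) <= c * (nm x + nm (S x) + nm (T x)).

(** For |l| >= 2 c the correction l^-1 [S,T] v has norm at most (|v| + |S v| + |T v|) / 2, and its
    share of |T v| is absorbed on the left. *)
Lemma op_yos_graph_bound l e : imaginary l -> 2 * c <= nm l -> dom T e ->
  F (J l e) -> nm (T (J l e)) <= 2 * nm (T e) + nm (J l e) + nm (S (J l e)).
Proof.
move=> il cl Te Fv; have lpos := imaginary_gt0 il.
have := bound_A Fv; have := op_yos_anticomm il Te Fv => TvE.
have := yos_bound surjS (T e - l^-1 *: A (J l e)) (imaginaryN il).
rewrite -TvE => le1 le2.
have := nmB (T e) (l^-1 *: A (J l e)); rewrite nmZ nmcV => le3.
have : (nm l)^-1 * nm (A (J l e)) <=
    (nm (J l e) + nm (S (J l e)) + nm (T (J l e))) / 2.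
  rewrite mulrC ler_pdivrMr//; apply: le_trans le2 _.
  have : 0 <= nm (J l e) + nm (S (J l e)) + nm (T (J l e)).
    by rewrite !addr_ge0 ?nm_ge0.
  by set s := _ + _ + nm (T _); nra.
lra.
Qed.

Lemma anticomm_yos_bound l e : imaginary l -> 2 * c <= nm l -> dom T e ->
  F (J l e) ->
  nm (A (J l e)) <= 2 * c * (nm (J l e) + nm (S (J l e)) + nm (T e)).
Proof.
move=> il cl Te Fv; have := bound_A Fv.
have := op_yos_graph_bound il cl Te Fv.
have c0 := le_trans ler01 c1.
by move=> /(ler_wpM2l c0) le1 /le_trans; apply; lra.
Qed.

(** Extends the core condition to all of D(T). For u_n in the core tending to e in graph norm,
    [op_yos_graph_bound] makes T J_l u_n Cauchy; then T S J_l u_n converges, [S,T] J_l u_n is Cauchy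
    by the commutator bound, so S T J_l u_n converges too, and closedness of S and T concludes. *)
Lemma yos_Fdom l e (C : set E) : imaginary l -> 2 * c <= nm l ->
  core T C -> resolvent_image S l C `<=` F -> dom T e -> F (J l e).
Proof.
move=> il cl [subC CT denseC] imC Te.
have /choice[u uP] : forall n : nat, exists a,
    [/\ C a, nm (e - a) <= n.+1%:R^-1 & nm (T (e - a)) <= n.+1%:R^-1].
  move=> n; have n0 : 0 < n.+1%:R^-1 :> R by rewrite invr_gt0.
  have [a Ca lt_a] := denseC e Te _ n0; exists a.
  have le2 : nm (graph_inner T (e - a) (e - a)) <= n.+1%:R^-1 ^+ 2.
    rewrite -lecR -nmE rmorphXn/= -[leLHS]sqrtCK ltW//.
    by rewrite ltrXn2r ?sqrtC_ge0// ?normr_ge0.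
  have c_ee := inner_ge0 (e - a); have c_TT := inner_ge0 (T (e - a)).
  split=> //.
    rewrite -ler_sqr ?nnegrE ?nm_ge0 ?(ltW n0)//; apply: le_trans le2.
    by rewrite -nm_inner nm_cpos_le.
  rewrite -ler_sqr ?nnegrE ?nm_ge0 ?(ltW n0)//; apply: le_trans le2.
  by rewrite -nm_inner /graph_inner (addrC (inner (e - a) _)) nm_cpos_le.
have Cu n : C (u n) by have [] := uP n.
have Tu n : dom T (u n) by exact: CT.
have Fv n : F (J l (u n)).
  apply: imC; split; first exact: yos_dom.
  by rewrite op_yos// scalerBr subrK; exact: (submodZ subC).
have small (a : nat -> E) b : (forall n, nm (b - a n) <= n.+1%:R^-1) -> cvs a b.
  move=> ab d d0; have := near_divn ler01 d0; apply: filterS => n.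
  by rewrite mul1r; apply: le_trans; rewrite nm_subC.
have ue : cvs u e by apply: small => n; have [] := uP n.
have Tue : cvs (fun n => T (u n)) (T e).
  by apply: small => n; have [_ _] := uP n; rewrite appB.
have ve : cvs (fun n => J l (u n)) (J l e).
  apply: (cvs_le ler01 ue); near=> n.
  by rewrite -yosB// mul1r yos_bound.
have SvE n : S (J l (u n)) = l *: (u n - J l (u n)) by rewrite op_yos.
have Sve : cvs (fun n => S (J l (u n))) (S (J l e)).
  rewrite op_yos//; have := cvsZ l (cvsD ue (cvsN ve)).
  by move=> cv d d0; have := cv d d0; apply: filterS => n; rewrite SvE.
have cTv : cauchys (fun n => T (J l (u n))).
  apply: (@cauchys_le _ _ _ _ _ _ (fun n => J l (u n)) (fun n => S (J l (u n)))
     (fun n => T (u n)) 2) => //.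
  - exact: cvs_cauchy ve.
  - exact: cvs_cauchy Sve.
  - exact: cvs_cauchy Tue.
  exists 0%N => m n _ _.
  have [Sm Tm TSm STm] := Fv m; have [Sn Tn TSn STn] := Fv n.
  have Fmn : F (J l (u m - u n)) by rewrite yosB//; exact: FdomB.
  have := op_yos_graph_bound il cl (domB (Tu m) (Tu n)) Fmn.
  rewrite yosB// !appB//.
  have := nm_ge0 (J l (u m) - J l (u n)).
  have := nm_ge0 (S (J l (u m)) - S (J l (u n))).
  lra.
have [w Tvw] := cauchys_cvs cTv.
have Tv n : dom T (J l (u n)) by have [] := Fv n.
have [Tve TvE] := clT Tv ve Tvw; rewrite -{}TvE in Tvw.
have TSve : dom T (S (J l e)) by rewrite op_yos//; apply/domZ/domB.
have TSvE n : T (S (J l (u n))) = l *: (T (u n) - T (J l (u n))).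
  by rewrite SvE appZ ?appB//; exact: domB.
have cTSv : cauchys (fun n => T (S (J l (u n)))).
  apply: (@cvs_cauchy _ _ _ (l *: (T e - T (J l e)))).
  move=> d d0; have := cvsZ l (cvsD Tue (cvsN Tvw)) d0.
  by apply: filterS => n; rewrite TSvE.
have cA : cauchys (fun n => A (J l (u n))).
  apply: (@cauchys_le _ _ _ _ _ _ (fun n => J l (u n)) (fun n => S (J l (u n)))
     (fun n => T (J l (u n))) c).
  - exact: le_trans ler01 c1.
  - exact: cvs_cauchy ve.
  - exact: cvs_cauchy Sve.
  - exact: cTv.
  exists 0%N => m n _ _.
  have [Sm Tm TSm STm] := Fv m; have [Sn Tn TSn STn] := Fv n.
  rewrite -anticommB//; have := bound_A (FdomB (Fv m) (Fv n)).
  by rewrite !appB.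
have cSTv : cauchys (fun n => S (T (J l (u n)))).
  apply: (@cauchys_le _ _ _ _ _ _ (fun n => A (J l (u n)))
     (fun n => T (S (J l (u n)))) (fun n => T (S (J l (u n)))) 1) => //.
  exists 0%N => m n _ _; rewrite mul1r.
  have STE k : S (T (J l (u k))) = A (J l (u k)) - T (S (J l (u k))).
    by rewrite /anticomm addrK.
  rewrite !STE.
  have -> : A (J l (u m)) - T (S (J l (u m))) -
      (A (J l (u n)) - T (S (J l (u n)))) =
      (A (J l (u m)) - A (J l (u n))) - (T (S (J l (u m))) - T (S (J l (u n)))).
    by lmod_coefs R[i]; ring.
  have := nmB (A (J l (u m)) - A (J l (u n)))
    (T (S (J l (u m))) - T (S (J l (u n)))).
  by have := nm_ge0 (T (S (J l (u m))) - T (S (J l (u n)))); lra.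
have [w' STvw] := cauchys_cvs cSTv.
have STv n : dom S (T (J l (u n))) by have [] := Fv n.
have [STve _] := clS STv Tvw STvw.
by split => //; exact: yos_dom.
Unshelve. all: end_near. Qed.

End Bounds.
End Anticommutator.

(** * The sum and its square *)

Section Sum.
Variables (R : realType) (B : cstarAlgType R) (E : hilbertModType B).
Variables (S T : operator E).
Hypotheses (surjS : nonreal_surj S) (surjT : nonreal_surj T).
Hypotheses (clS : closed_op S) (clT : closed_op T).
Hypotheses (dS : dense (dom S)) (dT : dense (dom T)).
Implicit Types (x y e u v : E) (l t : R[i]).

Local Notation A := (anticomm S T).
Local Notation F := (Fdom S T).
Local Notation J := (yos S).

Variables c l0 : R.
Hypothesis c1 : 1 <= c.
Hypothesis bound_A :
  forall x, F x -> nm (A x) <= c * (nm x + nm (S x) + nm (T x)).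
Hypothesis l0c : 2 * c <= l0.
Hypothesis J_F : forall l e, imaginary l -> l0 <= nm l -> dom T e -> F (J l e).

Let symS := surjS.1.
Let symT := surjT.1.
Let c0 : 0 <= c := le_trans ler01 c1.

(** For imaginary l this is |l|^2 (S^2 + |l|^2)^-1. T exchanges J_l and J_-l up to order l^-1 and so
    nearly commutes with their average. *)
Definition avg l u : E := (2^-1)%:C *: (J l u + J (- l) u).

Lemma half_le (a b m : R) : a <= m -> b <= m -> nm (2^-1)%:C * (a + b) <= m.
Proof. by move=> am bm; rewrite nmR ger0_norm ?invr_ge0//; lra. Qed.

Lemma avgD l u v : imaginary l -> avg l (u + v) = avg l u + avg l v.
Proof.
move=> il; rewrite /avg !yosD//; try exact: imaginaryN.
by lmod_coefs R[i]; ring.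
Qed.

Lemma avgZ l (a : R[i]) u : imaginary l -> avg l (a *: u) = a *: avg l u.
Proof.
move=> il; rewrite /avg !yosZ//; try exact: imaginaryN.
by lmod_coefs R[i]; ring.
Qed.

Lemma avg_dom l u : imaginary l -> dom S (avg l u).
Proof.
move=> il; apply/domZ/domD; apply: yos_dom => //; exact: imaginaryN.
Qed.

Lemma op_avg l u : imaginary l ->
  S (avg l u) = (2^-1)%:C *: (S (J l u) + S (J (- l) u)).
Proof.
move=> il; have iN := imaginaryN il; have d1 := yos_dom surjS u il.
have d2 := yos_dom surjS u iN.
by rewrite appZ ?appD//; exact: domD.
Qed.

Lemma avg_comm l u : imaginary l -> dom S u -> S (avg l u) = avg l (S u).
Proof.
move=> il Su; rewrite op_avg// !yos_comm//; exact: imaginaryN.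
Qed.

Lemma op_avg_bound l u : imaginary l -> nm (S (avg l u)) <= nm l * nm u.
Proof.
move=> il; rewrite op_avg// nmZ.
rewrite (le_trans (ler_wpM2l (nm_ge0 _) (nmD _ _)))//.
apply: half_le; first exact: op_yos_bound.
by rewrite -(nmN l); apply: op_yos_bound => //; exact: imaginaryN.
Qed.

Lemma avg_yos l m u : imaginary l -> imaginary m ->
  avg l (J m u) = J m (avg l u).
Proof.
move=> il im; rewrite /avg yosZ// yosD//.
by rewrite !(yos_yos _ _ im)//; exact: imaginaryN.
Qed.

Lemma avg_cvs_seq (L : nat -> R[i]) (u : nat -> E) y :
  diverging L -> cvs u y ->
  cvs (fun n => avg (L n) (u n)) y.
Proof.
move=> LP uy.
have LN := divergingN LP.
have -> : y = (2^-1)%:C *: (y + y).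
  by lmod_coefs R[i]; rewrite fmorphV/= rmorph_nat; field.
by apply/cvsZ/cvsD; exact: yos_cvs_seq.
Qed.

Lemma avg_Fdom l e : imaginary l -> l0 <= nm l -> dom T e -> F (avg l e).
Proof.
move=> il le_l Te; apply/FdomZ/FdomD; apply: J_F => //.
  exact: imaginaryN.
by rewrite nmN.
Qed.

Lemma op_avg_anticomm l e : imaginary l -> l0 <= nm l -> dom T e ->
  T (avg l e) = avg l (T e) +
    ((2^-1)%:C * l^-1) *: (J l (A (J (- l) e)) - J (- l) (A (J l e))).
Proof.
move=> il le_l Te; have [_ l_neq0] := il; have iN := imaginaryN il.
have Fp : F (J l e) by exact: J_F.
have Fm : F (J (- l) e) by apply: J_F => //; rewrite nmN.
have [_ Tp _ _] := Fp; have [_ Tm _ _] := Fm.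
rewrite /avg appZ ?appD//; last exact: domD.
rewrite (op_yos_anticomm surjS il Te Fp) (op_yos_anticomm surjS iN Te Fm) opprK.
rewrite !yosB// !yosZ//.
by lmod_coefs R[i]; field.
Qed.

Lemma anticomm_yos_le l e : imaginary l -> l0 <= nm l -> dom T e ->
  nm (A (J l e)) <= 2 * c * (nm e + nm (S (J l e)) + nm (T e)).
Proof.
move=> il le_l Te; have Fv := J_F il le_l Te.
have le1 := anticomm_yos_bound surjS c1 bound_A il (le_trans l0c le_l) Te Fv.
apply: le_trans le1 _; rewrite ler_wpM2l ?mulr_ge0// lerD2r lerD2r.
exact: yos_bound.
Qed.

(** * Yosida approximation of S + T *)

Lemma yosida_lower (r : R) t x : 0 < r -> imaginary t -> dom T x ->
  nm t * nm x <= nm (S (J (r%:C * t) x) + T x + t *: x).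
Proof.
move=> r0 it Tx; have il := imaginaryZ r0 it; set l := r%:C * t.
set y := _ + t *: x.
have r10 : 0 < 1 + r by rewrite addr_gt0.
have it' := imaginaryZ r10 it.
have [_] := shift_bound ((1 + r)%:C * t) symT Tx.
(* Since S J_l = l (1 - J_l), the equation is a shift of T by t + l. As l is a positive multiple of
   t, |t + l| = |t| + |l|, so the loss |l| |x| leaves |t| |x|. *)
have -> : T x + ((1 + r)%:C * t) *: x = y + l *: J l x.
  rewrite /y op_yos// /l.
  by lmod_coefs R[i]; rewrite rmorphD rmorph1; ring.
rewrite -imaginary_nm// nmcM nmR gtr0_norm// => le1.
have := nmD y (l *: J l x); rewrite (nmZ l (J l x)).
rewrite {2}/l nmcM nmR gtr0_norm// => le2.
have := ler_wpM2l (mulr_ge0 (ltW r0) (nm_ge0 t)) (yos_bound surjS x il).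
rewrite -/l; lra.
Qed.

(** The same rewriting turns the equation into the fixed point problem z = y + l J_l Q z with Q = (T
    + t + l)^-1; the ratio is |l| / |t + l| = r / (1 + r). *)
Lemma yosida_exists (r : R) t y : 0 < r -> imaginary t ->
  exists2 x, dom T x & S (J (r%:C * t) x) + T x + t *: x = y.
Proof.
move=> r0 it; have il := imaginaryZ r0 it; set l := r%:C * t.
have r10 : 0 < 1 + r by rewrite addr_gt0.
have it' := imaginaryZ r10 it; set t' := (1 + r)%:C * t.
have /choice[Q QP] : forall z, exists x, dom T x /\ T x + t' *: x = z.
  by move=> z; have [x] := surjT.2 _ (imaginary_Im it') z; exists x.
have q01 : 0 <= r / (1 + r) < 1.
  by rewrite divr_ge0 ?ltW//= ltr_pdivrMr// mul1r ltrDr.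
have [|z zP] := @contraction_fixpoint _ _ (fun z => y + l *: J l (Q z)) _ q01.
  move=> z w; have [Tz Ez] := QP z; have [Tw Ew] := QP w.
  have [_] := shift_bound t' symT (domB Tz Tw).
  have -> : T (Q z - Q w) + t' *: (Q z - Q w) = z - w.
    transitivity (T (Q z) + t' *: Q z - (T (Q w) + t' *: Q w)).
      by rewrite appB//; lmod_coefs R[i]; ring.
    by rewrite Ez Ew.
  rewrite -imaginary_nm// /t' nmcM nmR gtr0_norm// => le1.
  have -> : y + l *: J l (Q z) - (y + l *: J l (Q w)) = l *: J l (Q z - Q w).
    by rewrite yosB//; lmod_coefs R[i]; ring.
  rewrite (nmZ l) {1}/l nmcM nmR gtr0_norm//.
  rewrite [leRHS]mulrAC ler_pdivlMr//.
  have := yos_bound surjS (Q z - Q w) il.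
  move=> /(ler_wpM2l (mulr_ge0 (mulr_ge0 (ltW r0) (nm_ge0 t)) (ltW r10))).
  by move: (ler_wpM2l (ltW r0) le1); rewrite -/l; lra.
have [Tz Ez] := QP z; exists (Q z) => //.
have -> : y = z - l *: J l (Q z) by rewrite -{1}zP addrK.
rewrite -[X in _ = X - _]Ez op_yos// /t' /l.
by lmod_coefs R[i]; rewrite rmorphD rmorph1; ring.
Qed.

(* The term <Sv, T S v> / l is skew because l is imaginary. *)
Lemma yosida_identity (r : R) t x : 0 < r -> imaginary t ->
  l0 <= nm (r%:C * t) -> dom T x ->
  let v := J (r%:C * t) x in let y := S v + T x + t *: x in
  (2 * (1 + r^-1))%:C *: inner (S v) (S v) =
  inner (S v) y + inner y (S v) - inner v (A v).
Proof.
move=> r0 it; have il := imaginaryZ r0 it; set l := r%:C * t => le_l Tx v y.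
have Fv : F v by exact: J_F.
have [Sv Tv TSv STv] := Fv; have [tc t_neq0] := it; have [_ l_neq0] := il.
have rC : r%:C != 0 by rewrite fmorph_eq0 gt_eqF.
(* Everything is expressed through v, which lies in F(S,T). The term t l^-1 S v = r^-1 S v produces
   the factor 1 + r^-1. *)
have xE : x = v + l^-1 *: S v.
  by rewrite op_yos// scalerA mulVf// scale1r -/v subrKC.
have TxE : T x = T v + l^-1 *: T (S v).
  by rewrite {1}xE appD ?appZ//; exact: domZ.
rewrite /y TxE [X in t *: X]xE !innerE tc (imaginaryV il).
rewrite (symS Sv Sv) (symS Sv STv) (symT Tv TSv) (symT TSv TSv).
rewrite -/l.
have -> : l^-1 = r%:C^-1 * t^-1 by rewrite /l invfM.
by lmod_coefs R[i]; rewrite ?(rmorphM, rmorphD, rmorph1, fmorphV)/= ?rmorph_nat;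
  field; rewrite ?rC ?t_neq0.
Qed.

(** For a = |S v| and b = |y| the estimate reads 2 a^2 <= 8 a b + 4 b * 2 c (3 b + 2 a); if b <= a,
    the right side is at most 2 (4 + 20 c) a b. *)
Definition yosida_const := 4 + 20 * c.
Local Notation M := yosida_const.

Lemma yosida_const_ge1 : 1 <= M.
Proof. by move: c0; rewrite /M; lra. Qed.

(** The point is that the constants do not depend on r. *)
Lemma yosida_bound (r : R) t x : 0 < r -> imaginary t -> 1 <= nm t ->
  l0 <= nm (r%:C * t) -> dom T x ->
  let y := S (J (r%:C * t) x) + T x + t *: x in
  [/\ nm x <= nm y, nm (S (J (r%:C * t) x)) <= M * nm y &
      nm (T x) <= (2 + M) * nm y].
Proof.
move=> r0 it t1 le_l Tx y; have il := imaginaryZ r0 it.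
have lower := yosida_lower r0 it Tx.
have := yosida_identity r0 it le_l Tx; rewrite -/y in lower *.
set l := r%:C * t in il le_l y lower *; set v := J l x => /= ident.
have xy : nm x <= nm y by move: t1 lower (nm_ge0 x); nra.
have vy : nm v <= nm y by exact: le_trans (yos_bound surjS x il) xy.
have Txy : nm (T x) <= 2 * nm y + nm (S v).
  have -> : T x = y - S v - t *: x by rewrite /y -/v; lmod_coefs R[i]; ring.
  have := nmB (y - S v) (t *: x); have := nmB y (S v); rewrite nmZ; lra.
have Av := anticomm_yos_le il le_l Tx.
have Av' : nm (A v) <= 2 * c * (3 * nm y + 2 * nm (S v)).
  by apply: le_trans Av _; rewrite ler_wpM2l ?mulr_ge0// -/v; lra.
have Sq : 2 * nm (S v) ^+ 2 <= 8 * (nm (S v) * nm y) + 4 * (nm v * nm (A v)).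
  have := congr1 (@nm _ _) ident; rewrite nmZ nmR nm_inner.
  have r1 : 0 <= r^-1 by rewrite invr_ge0 ltW.
  rewrite ger0_norm ?mulr_ge0 ?addr_ge0// => e.
  have := nmB (inner (S v) y + inner y (S v)) (inner v (A v)).
  have := nmD (inner (S v) y) (inner y (S v)).
  have := inner_bound (S v) y; have := inner_bound y (S v).
  have := inner_bound v (A v).
  by have := mulr_ge0 r1 (sqr_ge0 (nm (S v))); rewrite -e; nra.
have vA : nm v * nm (A v) <= nm y * (2 * c * (3 * nm y + 2 * nm (S v))).
  by apply: ler_pM; rewrite ?nm_ge0.
have SvM : nm (S v) <= M * nm y.
  have := nm_ge0 (S v); have := nm_ge0 y; move: Sq vA c0.
  rewrite /M; move: (nm (S v)) (nm y) (nm v * nm (A v)) => a b d.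
  move=> Sq vA c_ge0 b0 a0.
  rewrite leNgt; apply/negP => lt_a.
  have : b <= a by have := mulr_ge0 c_ge0 b0; lra.
  have := mulr_ge0 c_ge0 b0; nra.
by split=> //; rewrite mulrDl; lra.
Qed.

Lemma yosida_equicontinuous (r s : R) t x : 0 < s -> s <= r -> imaginary t ->
  1 <= nm t -> l0 <= nm (s%:C * t) -> dom T x ->
  let w := S (J (r%:C * t) x) in let y := w + T x + t *: x in
  nm (w - avg (s%:C * t) w) <=
  M * (nm (y - avg (s%:C * t) y) + 6 * c * (1 + M) * nm y / nm (s%:C * t)).
Proof.
move=> s0 sr it t1 le_s Tx; have r0 : 0 < r := lt_le_trans s0 sr.
have il := imaginaryZ r0 it; have ik := imaginaryZ s0 it.
have kl : nm (s%:C * t) <= nm (r%:C * t).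
  by rewrite !nmcM !nmR !gtr0_norm// ler_wpM2r ?nm_ge0.
have le_r := le_trans le_s kl.
set l := r%:C * t in il kl le_r *; set k := s%:C * t in ik kl le_s *.
cbv zeta; set w := S (J l x); set y := w + T x + t *: x.
have [xy wy Txy] := yosida_bound r0 it t1 le_r Tx.
rewrite -/l -/w -/y in xy wy Txy.
have Tz : dom T (x - avg k x).
  by apply: domB => //; have [] := avg_Fdom ik le_s Tx.
have [_ + _] := yosida_bound r0 it t1 le_r Tz; rewrite -/l.
have Sx := yos_dom surjS x il.
have -> : S (J l (x - avg k x)) = w - avg k w.
  rewrite yosB// -avg_yos// appB//; last exact: avg_dom.
  by rewrite avg_comm.
set d := ((2^-1)%:C * k^-1) *: (J k (A (J (- k) x)) - J (- k) (A (J k x))).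
have -> : w - avg k w + T (x - avg k x) + t *: (x - avg k x) =
    y - avg k y - d.
  have Tavg : dom T (avg k x) by have [] := avg_Fdom ik le_s Tx.
  rewrite appB// op_avg_anticomm// -/d /y !avgD// avgZ//.
  by lmod_coefs R[i]; ring.
move=> /le_trans; apply; rewrite ler_wpM2l ?(le_trans ler01 yosida_const_ge1)//.
apply: le_trans (nmB _ _) _; rewrite lerD2l.
have k0 : 0 < nm k by exact: imaginary_gt0.
have bound_AJ k' : imaginary k' -> nm k' = nm k ->
    nm (A (J k' x)) <= 6 * c * (1 + M) * nm y.
  move=> ik' nk'; have le_k' : l0 <= nm k' by rewrite nk'.
  apply: le_trans (anticomm_yos_le ik' le_k' Tx) _.
  have SJ : nm (S (J k' x)) <= 2 * M * nm y.
    (* Then S J_k' x = J_k' w + l^-1 S J_k' w, both terms at most |w|: the second because |k'| = |k|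
       <= |l|. *)
    have xE : x = J l x + l^-1 *: w.
      by rewrite /w op_yos// scalerA mulVf ?scale1r ?subrKC//; have [] := il.
    rewrite {1}xE yosD// yosZ// appD ?appZ//; try exact/domZ/yos_dom;
      try exact: yos_dom.
    apply: le_trans (nmD _ _) _; rewrite yos_comm// -/w nmZ nmcV.
    have := yos_bound surjS w ik'; have := op_yos_bound surjS w ik'.
    rewrite nk' => le1 le2.
    have : (nm l)^-1 * nm (S (J k' w)) <= nm w.
      rewrite ler_pdivrMl ?imaginary_gt0//; apply: le_trans le1 _.
      by rewrite ler_wpM2r ?nm_ge0.
    by lra.
  have M1 := yosida_const_ge1; have y0 := nm_ge0 y.
  have : nm x + nm (S (J k' x)) + nm (T x) <= 3 * (1 + M) * nm y by lra.
  have c20 : 0 <= 2 * c by rewrite mulr_ge0.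
  by move=> /(ler_wpM2l c20); lra.
rewrite /d nmZ nmcM nmcV nmR ger0_norm ?invr_ge0//.
rewrite mulrAC ler_wpM2r ?invr_ge0 ?nm_ge0//.
have iN := imaginaryN ik; have nN : nm (- k) = nm k by rewrite nmN.
have := nmB (J k (A (J (- k) x))) (J (- k) (A (J k x))).
have := yos_bound surjS (A (J (- k) x)) ik.
have := yos_bound surjS (A (J k x)) iN.
have := bound_AJ _ ik erefl; have := bound_AJ _ iN nN.
lra.
Qed.

(** Take v = J_l x for a solution x of the approximating equation, l = L n. The delicate part of the
    residual is P (T x), where P = 1 - J_-l and T x = y - S v - t x: S v varies with n and is only
    bounded, so pointwise convergence of P to 0 does not suffice and equicontinuity is used. *)
Lemma sum_range_dense t y (e : R) : imaginary t -> 1 <= nm t -> 0 < e ->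
  exists2 v, dom S v /\ dom T v & nm (y - (S v + T v + t *: v)) <= e.
Proof.
move=> it t1 e0; pose L n := n.+1%:R%:C * t.
have n0 n : 0 < n.+1%:R :> R by [].
have iL n : imaginary (L n) by apply: imaginaryZ.
have nL n : nm (L n) = n.+1%:R * nm t by rewrite /L nmcM nmR gtr0_norm.
have LP : diverging L by move=> n; split=> //; rewrite nL ler_peMr.
have LN := divergingN LP.
have /choice[x xP] : forall n, exists x,
    dom T x /\ S (J (L n) x) + T x + t *: x = y.
  by move=> n; have [x] := yosida_exists y (n0 n) it; exists x.
have M1 := yosida_const_ge1; have M0 : 0 < M := lt_le_trans ltr01 M1.
have y0 := nm_ge0 y.
have d0 : 0 < e / (16 * M) by rewrite divr_gt0 ?mulr_gt0.
have K0 : 0 <= 6 * c * (1 + M) * nm y by rewrite !(mulr_ge0, addr_ge0).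
have nearL := diverging_ge l0 LP.
(* The cut-off k is fixed before n. The two errors, multiplied by M, add up to e / 8, which P at
   most doubles to e / 4. *)
have [k [kl0 ky kK]] : exists k, [/\ l0 <= nm (L k),
    nm (y - avg (L k) y) <= e / (16 * M) &
    6 * c * (1 + M) * nm y / nm (L k) <= e / (16 * M)].
  near \oo => k; exists k; split; first by near: k.
    by rewrite nm_subC; near: k; exact: avg_cvs_seq (cvs_cst y) _ d0.
  have : 6 * c * (1 + M) * nm y / k.+1%:R <= e / (16 * M).
    by near: k; exact: near_divn.
  apply: le_trans; rewrite ler_wpM2l// lef_pV2 ?posrE ?imaginary_gt0//.
  exact: (LP k).2.
(* Collects all terms of order 1 / n: (k + 1) M from P (avg w), 3 M from t P x, M from t (x - v),
   and the rest from l^-1 [S,T] v. *)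
have C0 : 0 <= (k.+1%:R * M + 4 * M + 2 * c * (3 + 2 * M)) * nm y.
  rewrite mulr_ge0//; have kM := mulr_ge0 (ler0n R k.+1) (ltW M0).
  have cM : 0 <= c * (3 + 2 * M) by rewrite mulr_ge0//; lra.
  by lra.
have e80 : 0 < e / 8 by rewrite divr_gt0.
near \oo => n.
have ln : l0 <= nm (L n) by near: n.
have kn : (k <= n)%N by near: n; exact: nbhs_infty_ge.
have Py : nm (y - J (- L n) y) <= e / 8.
  by rewrite nm_subC; near: n; exact: (yos_cvs surjS y dS LN e80).
have Cn : (k.+1%:R * M + 4 * M + 2 * c * (3 + 2 * M)) * nm y / n.+1%:R <= e / 8.
  by near: n; exact: near_divn.
pose nu : R := n.+1%:R^-1; rewrite -/nu in Cn.
have [Tx xE] := xP n.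
have kn' : k.+1%:R <= n.+1%:R :> R by rewrite ler_nat.
have := yosida_equicontinuous (n0 k) kn' it t1 kl0 Tx.
have := yosida_bound (n0 n) it t1 ln Tx; rewrite -/(L n) -/(L k) xE.
set v := J (L n) (x n); set w := S v => -[xy wy Txy] equi.
have yE : w + T (x n) + t *: x n = y := xE.
cbv zeta in equi; rewrite yE in equi.
have iN := imaginaryN (iL n); have nN : nm (- L n) = nm (L n) by rewrite nmN.
have Fv : F v by exact: J_F.
have [Sv Tv _ _] := Fv; exists v => //.
have l_pos : 0 < nm (L n) := imaginary_gt0 (iL n).
have l_ge : n.+1%:R <= nm (L n) := (LP n).2.
have [_ l_neq0] := iL n.
have xv : x n - v = (L n)^-1 *: w.
  by rewrite /w op_yos// scalerA mulVf// scale1r.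
pose P u := u - J (- L n) u.
have P2 u : nm (P u) <= 2 * nm u.
  by have := nmB u (J (- L n) u); have := yos_bound surjS u iN; rewrite /P; lra.
have PS u : dom S u -> nm (P u) <= nm (S u) / nm (L n).
  by move=> Su; rewrite -nN; exact: yos_near.
have PB u z : P (u - z) = P u - P z.
  by rewrite /P yosB//; lmod_coefs R[i]; ring.
have PZ (a : R[i]) u : P (a *: u) = a *: P u.
  by rewrite /P yosZ//; lmod_coefs R[i]; ring.
have wn : nm w * nu <= M * nm y * nu.
  by rewrite ler_wpM2r// /nu invr_ge0.
have wl : nm t * (nm w / nm (L n)) = nm w * nu.
  rewrite /nu nL invfM mulrCA (mulrCA (nm t)) mulfV ?mulr1//.
  by rewrite gt_eqF// (lt_le_trans ltr01).
have tPx : nm (t *: P (x n)) <= 3 * (M * nm y * nu).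
  have -> : x n = v - - (x n - v) by lmod_coefs R[i]; ring.
  rewrite PB nmZ; have := nmB (P v) (P (- (x n - v))).
  have := PS v Sv; have := P2 (- (x n - v)); rewrite nmN xv nmZ nmcV -/w.
  rewrite [_^-1 * nm w]mulrC => le1 le2 le3.
  have : nm (P v - P (- ((L n)^-1 *: w))) <= 3 * (nm w / nm (L n)) by lra.
  by move=> /(ler_wpM2l (nm_ge0 t)); rewrite mulrCA wl; lra.
(* avg w lies in D(S) with |S avg w| <= |L k| |w|, so P makes it small for n much larger than k; the
   remainder is the uniformly small tail. *)
have Pw : nm (P w) <= k.+1%:R * (M * nm y * nu) + e / 4.
  have -> : w = avg (L k) w - - (w - avg (L k) w) by lmod_coefs R[i]; ring.
  rewrite PB; apply: le_trans (nmB _ _) _; apply: lerD.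
    apply: le_trans (PS _ (avg_dom w (iL k))) _.
    have := op_avg_bound w (iL k).
    have li : 0 <= (nm (L n))^-1 by rewrite invr_ge0 ltW.
    move=> /(ler_wpM2r li) /le_trans; apply.
    by rewrite nL -!mulrA wl (mulrA M) ler_wpM2l.
  apply: le_trans (P2 _) _; rewrite nmN.
  have : M * (nm (y - avg (L k) y) + 6 * c * (1 + M) * nm y / nm (L k)) <= e / 8.
    apply: le_trans (ler_wpM2l (ltW M0) (lerD ky kK)) _.
    rewrite le_eqVlt; apply/orP; left; apply/eqP; field; exact: lt0r_neq0.
  move=> /(le_trans equi); lra.
have PTx : nm (P (T (x n))) <=
    e / 8 + (k.+1%:R * (M * nm y * nu) + e / 4) + 3 * (M * nm y * nu).
  have -> : T (x n) = y - w - t *: x n.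
    by rewrite -xE; lmod_coefs R[i]; ring.
  rewrite !PB PZ; apply: le_trans (nmB _ _) _; apply: lerD => //.
  by apply: le_trans (nmB _ _) _; apply: lerD.
have Av : nm ((L n)^-1 *: A v) <= 2 * c * (3 + 2 * M) * nm y * nu.
  rewrite nmZ nmcV mulrC; apply: ler_pM; rewrite ?nm_ge0 ?invr_ge0 ?nm_ge0//.
    have c20 : 0 <= 2 * c by rewrite mulr_ge0.
    apply: le_trans (anticomm_yos_le (iL n) ln Tx) _.
    by rewrite -[leRHS]mulrA ler_wpM2l// -/v -/w; lra.
  by rewrite /nu lef_pV2 ?posrE.
have -> : y - (w + T v + t *: v) =
    P (T (x n)) + (J (- L n) ((L n)^-1 *: A v) + t *: (x n - v)).
  rewrite -xE (op_yos_anticomm surjS (iL n) Tx Fv) -/v yosB// /P -/w.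
  by lmod_coefs R[i]; ring.
apply: le_trans (nmD _ _) _.
have := nmD (J (- L n) ((L n)^-1 *: A v)) (t *: (x n - v)).
have := yos_bound surjS ((L n)^-1 *: A v) iN.
have -> : nm (t *: (x n - v)) = nm w * nu.
  by rewrite xv !nmZ nmcV [_^-1 * _]mulrC wl.
clearbody nu; move: Cn wn PTx Av; lra.
Unshelve. all: end_near. Qed.

(** * Ellipticity and closedness of S + T and S - T *)

Lemma yos_graph_cvs L x : diverging L -> dom S x -> dom T x ->
  [/\ cvs (fun n => J (L n) x) x, cvs (fun n => S (J (L n) x)) (S x) &
      cvs (fun n => T (J (L n) x)) (T x)].
Proof.
move=> LP Sx Tx; have cJ := yos_cvs surjS x dS LP.
have cSJ : cvs (fun n => S (J (L n) x)) (S x).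
  move=> e e0; have := yos_cvs surjS (S x) dS LP e0; apply: filterS => n.
  by rewrite yos_comm//; have [] := LP n.
split=> //.
(* As x is also in D(S), S J_l x = J_l S x stays bounded, hence so does [S,T] J_l x. *)
have cA : cvs (fun n => (L n)^-1 *: A (J (L n) x)) 0.
  pose K := 2 * c * (nm x + nm (S x) + nm (T x)).
  have K0 : 0 <= K by rewrite !(mulr_ge0, addr_ge0, nm_ge0).
  move=> e e0; near=> n; have [iL nL] := LP n.
  have le_l : l0 <= nm (L n) by near: n; exact: diverging_ge.
  rewrite subr0 nmZ nmcV mulrC.
  have leK : nm (A (J (L n) x)) <= K.
    apply: le_trans (anticomm_yos_le iL le_l Tx) _.
    rewrite ler_wpM2l ?mulr_ge0// lerD2r lerD2l yos_comm//.
    exact: yos_bound.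
  have : K / n.+1%:R <= e by near: n; exact: near_divn.
  apply: le_trans; apply: ler_pM; rewrite ?nm_ge0 ?invr_ge0 ?nm_ge0//.
  by rewrite lef_pV2 ?posrE ?imaginary_gt0.
have := yos_cvs_seq surjS dS (divergingN LP) (cvsD (cvs_cst (T x)) (cvsN cA)).
rewrite subr0 => cT e e0; near=> n; have [iL nL] := LP n.
have le_l : l0 <= nm (L n) by near: n; exact: diverging_ge.
rewrite (op_yos_anticomm surjS iL Tx (J_F iL le_l Tx)).
by near: n; exact: cT.
Unshelve. all: end_near. Qed.

(** For N = |v| + |d| the quadratic estimate gives |S v| <= (4 + 6 c) N, and |S v| + |T v| <= |d| +
    2 |S v|. *)
Definition elliptic_const := 9 + 12 * c.

Lemma elliptic_const_ge0 : 0 <= elliptic_const.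
Proof. by move: c0; rewrite /elliptic_const; lra. Qed.

(** The hypotheses on s describe 1 and -1, so both S + T and S - T are covered; the anticommutator
    of S with s T is s [S,T]. *)
Lemma elliptic_Fdom (s : R[i]) v :
  s * s = 1 -> (s^*)%R = s -> nm s = 1 -> F v ->
  nm (S v) + nm (T v) <= elliptic_const * (nm v + nm (S v + s *: T v)).
Proof.
move=> ss sc s1 Fv; have [Sv Tv TSv STv] := Fv; set d := S v + s *: T v.
have TE : T v = s *: (d - S v).
  by rewrite /d addrAC subrr add0r scalerA ss scale1r.
have Tle : nm (T v) <= nm d + nm (S v).
  by rewrite TE nmZ s1 mul1r nmB.
have ident : 2%:C *: inner (S v) (S v) =
    inner (S v) d + inner d (S v) - s *: inner v (A v).
  rewrite /d !innerE sc (symS Sv STv) (symT Tv TSv).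
  by lmod_coefs R[i]; rewrite ?rmorph_nat; ring.
have Sq : 2 * nm (S v) ^+ 2 <= 8 * (nm (S v) * nm d) + 4 * (nm v * nm (A v)).
  have := congr1 (@nm _ _) ident; rewrite nmZ nmR nm_inner ger0_norm// => ->.
  have := nmB (inner (S v) d + inner d (S v)) (s *: inner v (A v)).
  have := nmD (inner (S v) d) (inner d (S v)); rewrite nmZ s1 mul1r.
  have := inner_bound (S v) d; have := inner_bound d (S v).
  have := inner_bound v (A v); rewrite (mulrC (nm d)); lra.
have Av : nm (A v) <= c * (nm v + 2 * nm (S v) + nm d).
  by apply: le_trans (bound_A Fv) _; rewrite ler_wpM2l//; lra.
have vA := ler_wpM2l (nm_ge0 v) Av.
move: (nm_ge0 (S v)) (nm_ge0 d) (nm_ge0 v) Sq vA Tle c0 c1.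
rewrite /elliptic_const.
move: (nm (S v)) (nm d) (nm v) (nm v * nm (A v)) (nm (T v)).
move=> a b n m t a0 b0 n0 Sq vA Tle c_ge0 c_ge1.
have N0 : 0 <= n + b by rewrite addr_ge0.
have aN : a <= (4 + 6 * c) * (n + b).
  rewrite leNgt; apply/negP; set N := n + b in N0 * => lt_a.
  have cN := mulr_ge0 c_ge0 N0.
  have Na : N <= a by lra.
  have aa : (4 + 6 * c) * N * a <= a * a by rewrite ler_wpM2r// ltW.
  have : a * b <= a * N by rewrite ler_wpM2l// /N; lra.
  have : n * (c * (n + 2 * a + b)) <= N * (c * (N + 2 * a)).
    apply: ler_pM => //; rewrite ?mulr_ge0 ?addr_ge0 ?mulr_ge0//.
      by rewrite /N; lra.
    by rewrite ler_wpM2l// /N; lra.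
  have : c * N * N <= c * N * a by rewrite ler_wpM2l.
  have a_gt0 : 0 < a by apply: le_lt_trans lt_a; rewrite mulr_ge0//; lra.
  have : (4 + 6 * c) * N * a < a * a by rewrite ltr_pM2r.
  by rewrite expr2 in Sq; lra.
lra.
Qed.

Lemma elliptic (s : R[i]) x : s * s = 1 -> (s^*)%R = s -> nm s = 1 ->
  dom S x -> dom T x ->
  nm (S x) + nm (T x) <= elliptic_const * (nm x + nm (S x + s *: T x)).
Proof.
move=> ss sc s1 Sx Tx; apply/ler_addgt0Pr => e e0.
pose L n : R[i] := 0 +i* n.+1%:R.
have LP : diverging L := @diverging_imag R.
have [cJ cSJ cTJ] := yos_graph_cvs LP Sx Tx.
pose C := elliptic_const; have C0 : 0 <= C := elliptic_const_ge0.
(* Replacing x by v costs 2 d on the left and 3 d inside the bracket on the right. *)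
have C3 : 0 < 2 + 3 * C by lra.
have d0 : 0 < e / (2 + 3 * C) by rewrite divr_gt0.
set d := e / _ in d0.
near \oo => n.
have le_l : l0 <= nm (L n) by near: n; exact: diverging_ge.
have xv : nm (J (L n) x - x) <= d by near: n; exact: cJ.
have Sxv : nm (S (J (L n) x) - S x) <= d by near: n; exact: cSJ.
have Txv : nm (T (J (L n) x) - T x) <= d by near: n; exact: cTJ.
have Fv : F (J (L n) x) by apply: J_F => //; have [] := LP n.
move: (J (L n) x) xv Sxv Txv Fv => v xv Sxv Txv Fv.
have := elliptic_Fdom ss sc s1 Fv.
have := nm_le_sub (S x) (S v); have := nm_le_sub (T x) (T v).
rewrite (nm_subC (S x)) (nm_subC (T x)) => le1 le2.
have le3 := nm_le_sub v x.
have le4 : nm (S v + s *: T v) <= nm (S x + s *: T x) + 2 * d.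
  apply: le_trans (nm_le_sub _ (S x + s *: T x)) _; rewrite lerD2l.
  have -> : S v + s *: T v - (S x + s *: T x) = (S v - S x) + s *: (T v - T x).
    by lmod_coefs R[i]; ring.
  by apply: le_trans (nmD _ _) _; rewrite nmZ s1; lra.
have : C * (nm v + nm (S v + s *: T v)) <=
       C * (nm x + nm (S x + s *: T x) + 3 * d) by rewrite ler_wpM2l//; lra.
have : d * (2 + 3 * C) = e by rewrite divfK// gt_eqF.
rewrite -/C; lra.
Unshelve. all: end_near. Qed.

(** Ellipticity makes S u_n and T u_n separately Cauchy, so closedness of S and of T applies to
    each. *)
Lemma sum_closed (s : R[i]) (u : nat -> E) x : s * s = 1 -> (s^*)%R = s ->
  nm s = 1 -> (forall n, dom S (u n)) -> (forall n, dom T (u n)) -> cvs u x ->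
  cauchys (fun n => S (u n) + s *: T (u n)) ->
  [/\ dom S x, dom T x, cvs (fun n => S (u n)) (S x) &
      cvs (fun n => T (u n)) (T x)].
Proof.
move=> ss sc s1 Su Tu ux cD; have cu := cvs_cauchy ux.
have C0 := elliptic_const_ge0.
have le_D m n : nm (S (u m) - S (u n)) + nm (T (u m) - T (u n)) <=
    elliptic_const * (nm (u m - u n) +
      nm (S (u m) + s *: T (u m) - (S (u n) + s *: T (u n))) + 0).
  have := elliptic ss sc s1 (domB (Su m) (Su n)) (domB (Tu m) (Tu n)).
  rewrite !appB// addr0 => /le_trans; apply; rewrite le_eqVlt; apply/orP; left.
  by apply/eqP; congr (_ * (_ + nm _)); lmod_coefs R[i]; ring.
have c00 : cauchys (fun n : nat => 0 : E) := cvs_cauchy (cvs_cst 0).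
have cS : cauchys (fun n => S (u n)).
  apply: (@cauchys_le _ _ _ _ _ _ u (fun n => S (u n) + s *: T (u n))
    (fun=> 0 : E) elliptic_const) => //.
  exists 0%N => m n _ _; rewrite subrr nm0; apply: le_trans (le_D m n).
  by rewrite lerDl nm_ge0.
have cT : cauchys (fun n => T (u n)).
  apply: (@cauchys_le _ _ _ _ _ _ u (fun n => S (u n) + s *: T (u n))
    (fun=> 0 : E) elliptic_const) => //.
  exists 0%N => m n _ _; rewrite subrr nm0; apply: le_trans (le_D m n).
  by rewrite lerDr nm_ge0.
have [y Suy] := cauchys_cvs cS; have [z Tuz] := cauchys_cvs cT.
have [Sx SxE] := clS Su ux Suy; have [Tx TxE] := clT Tu ux Tuz.
by rewrite SxE TxE.
Qed.

(** * Self-adjointness of S + T and the domain of its square *)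

Local Notation D := (op_add S T).

Lemma sum_symmetric : symmetric_op D.
Proof.
move=> x y [/= Sx Tx] [/= Sy Ty].
by rewrite innerDl innerD (symS Sx Sy) (symT Tx Ty).
Qed.

Lemma sum_closed_op : closed_op D.
Proof.
move=> u x y Du ux Duy.
have one1 : nm (1 : R[i]) = 1 by rewrite /nm normr1.
have [Sx Tx cS cT] : [/\ dom S x, dom T x, cvs (fun n => S (u n)) (S x) &
    cvs (fun n => T (u n)) (T x)].
  apply: (@sum_closed 1) => //; rewrite ?mulr1 ?conjC1//.
  - by move=> n; have [] := Du n.
  - by move=> n; have [] := Du n.
  move=> e e0; have [N DN] := cvs_cauchy Duy e0; exists N => m n Nm Nn.
  by rewrite !scale1r; exact: DN.
split; first by split.
exact: cvs_unique (cvsD cS cT) Duy.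
Qed.

Lemma sum_dense : dense (dom D).
Proof.
apply/denseP => x e e0; have e20 : 0 < e / 2 by rewrite divr_gt0.
have e40 : 0 < e / 4 by rewrite divr_gt0.
have /denseP/(_ x _ e20)[a Ta xa] := dT.
pose L n : R[i] := 0 +i* n.+1%:R.
have LP : diverging L := @diverging_imag R.
near \oo => n; have [iL _] := LP n.
have le_l : l0 <= nm (L n) by near: n; exact: diverging_ge.
have [Sv Tv _ _] := J_F iL le_l Ta.
exists (J (L n) a) => //.
have := nm_sub_trans a x (J (L n) a).
have : nm (J (L n) a - a) <= e / 4.
  by near: n; exact: (yos_cvs surjS a dS LP e40).
rewrite (nm_subC a); lra.
Unshelve. all: end_near. Qed.

Lemma sum_self_adjoint : self_adjoint D /\ regular D.
Proof.
have surjD (b : R) : `|b| = 1 -> surj_shift D (0 +i* b).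
  move=> b1; have ib : imaginary (0 +i* b : R[i]).
    split; first exact: conj_imag.
    by rewrite eq_complex/= eqxx/= -normr_gt0 b1.
  apply: (dense_surj sum_symmetric sum_closed_op (imaginary_Im ib)).
  apply/denseP => y e e0; have e20 : 0 < e / 2 by rewrite divr_gt0.
  have [|v [Sv Tv] yv] := @sum_range_dense (0 +i* b) y _ ib _ e20.
    by rewrite nmI b1.
  exists (S v + T v + (0 +i* b) *: v); first by exists v.
  by apply: le_lt_trans yv _; lra.
apply: (@symmetric_surj_self_adjoint _ _ _ _ (0 +i* 1)) => //.
- exact: sum_symmetric.
- exact: sum_dense.
- by rewrite /= oner_neq0.
- by apply: surjD; rewrite normr1.
- have -> : - (0 +i* 1) = 0 +i* (-1) :> R[i].
    by apply/eqP; rewrite eq_complex/= oppr0 !eqxx.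
  by apply: surjD; rewrite normrN normr1.
Qed.

(* With f = (S + T) x and u = S R x, R the average of the resolvents at
   +l and -l, the vector (S - T) u = R S f - ... stays convergent as l grows,
   so that ellipticity of S - T gives the regularity of S x. *)
Lemma sum_sqr_dom x : dom (op_sqr D) x ->
  [/\ F x, dom (op_sqr S) x & dom (op_sqr T) x].
Proof.
move=> [/= [Sx Tx] [Sf Tf]]; set f := S x + T x in Sf Tf.
(* The offset makes every index admissible, since [sum_closed] requires the whole sequence to lie in
   both domains. *)
pose L n : R[i] := 0 +i* (n.+1%:R + `|l0|).
have LP : diverging L.
  move=> n; have n0 : 0 < n.+1%:R + `|l0| by rewrite ltr_wpDr.
  split; last by rewrite nmI gtr0_norm// lerDl.
  split; first exact: conj_imag.
  by rewrite eq_complex/= eqxx/= gt_eqF.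
have iL n : imaginary (L n) by have [] := LP n.
have le_l n : l0 <= nm (L n).
  rewrite nmI gtr0_norm ?ltr_wpDr// (le_trans (ler_norm l0))//.
  by rewrite lerDr.
have iN n := imaginaryN (iL n).
have le_N n : l0 <= nm (- L n) by rewrite nmN.
have Fp n : F (J (L n) x) by exact: J_F.
have Fm n : F (J (- L n) x) by exact: J_F.
have cA (K : nat -> R[i]) : diverging K -> (forall n, F (J (K n) x)) ->
    exists a, cvs (fun n => A (J (K n) x)) a.
  move=> KP FK; have [cJ cSJ cTJ] := yos_graph_cvs KP Sx Tx.
  apply: cauchys_cvs; apply: (@cauchys_le _ _ _ _ _ _ (fun n => J (K n) x)
    (fun n => S (J (K n) x)) (fun n => T (J (K n) x)) c) => //.
  - exact: cvs_cauchy cJ.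
  - exact: cvs_cauchy cSJ.
  - exact: cvs_cauchy cTJ.
  exists 0%N => m n _ _.
  have [Sm Tm TSm STm] := FK m; have [Sn Tn TSn STn] := FK n.
  rewrite -anticommB//; have := bound_A (FdomB (FK m) (FK n)).
  by rewrite !appB.
have [ap cap] := cA _ LP Fp; have [am cam] := cA _ (divergingN LP) Fm.
pose u n := S (avg (L n) x).
have Fa n : F (avg (L n) x) by exact: avg_Fdom.
have uE n : u n = avg (L n) (S x) by rewrite /u avg_comm.
have Su n : dom S (u n) by rewrite uE; exact: avg_dom.
have Tu n : dom T (u n) by have [] := Fa n.
have ux : cvs u (S x).
  have := avg_cvs_seq LP (cvs_cst (S x)); move=> cv e e0.
  by have := cv e e0; apply: filterS => n; rewrite uE.
(* The uncontrolled S avg (T x) hidden in T u is absorbed by avg (S f) = S avg (S x) + S avg (T x).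
   The remaining commutator l^-1 S J_l contributes terms l^-1 l (1 - J_l), whose identity parts
   cancel [S,T] avg x. *)
have DuE n : S (u n) + (-1) *: T (u n) = avg (L n) (S f) -
    (2^-1)%:C *: (J (L n) (A (J (- L n) x)) + J (- L n) (A (J (L n) x))).
  have [Sa Ta TSa STa] := Fa n; have [_ l_neq0] := iL n.
  have AE : A (avg (L n) x) = (2^-1)%:C *: (A (J (L n) x) + A (J (- L n) x)).
    by rewrite /avg anticommZ ?anticommD//; exact: FdomD.
  have TE : T (u n) = A (avg (L n) x) - S (T (avg (L n) x)).
    by rewrite /anticomm /u addrC addKr.
  have SfE : avg (L n) (S f) = S (avg (L n) (T x)) + S (u n).
    rewrite -avg_comm// /f avgD// appD; [|exact: avg_dom|exact: avg_dom].
    by rewrite uE addrC.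
  rewrite TE AE op_avg_anticomm// SfE.
  set a1 := A (J (- L n) x); set a2 := A (J (L n) x).
  have d1 := yos_dom surjS a1 (iL n); have d2 := yos_dom surjS a2 (iN n).
  have da := avg_dom (T x) (iL n); have dd := domB d1 d2.
  rewrite (appD da (domZ _ dd)) (appZ _ dd) (appB d1 d2).
  rewrite !op_yos//.
  by lmod_coefs R[i]; rewrite ?fmorphV/= ?rmorph_nat; field; rewrite ?l_neq0.
have [|||||||Swx TSx _ _] := @sum_closed (-1) u (S x).
- by rewrite mulrNN mulr1.
- by rewrite rmorphN1.
- by rewrite nmN /nm normr1.
- exact: Su.
- exact: Tu.
- exact: ux.
- have c1' := avg_cvs_seq LP (cvs_cst (S f)).
  have c2 := yos_cvs_seq surjS dS LP cam.
  have c3 := yos_cvs_seq surjS dS (divergingN LP) cap.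
  have cD := cvs_cauchy (cvsD c1' (cvsN (cvsZ (2^-1)%:C (cvsD c2 c3)))).
  move=> e e0; have [N DN] := cD e e0; exists N => m n Nm Nn.
  by rewrite !DuE; exact: DN.
have TxE : T x = f - S x by rewrite /f addrC addKr.
have STx : dom S (T x) by rewrite TxE; exact: domB.
have TTx : dom T (T x) by rewrite TxE; exact: domB.
by split=> //; split.
Qed.

(** * Self-adjointness of S^2 + T^2 *)

Local Notation H := (op_add (op_sqr S) (op_sqr T)).

Lemma op_sqr_symmetric (U : operator E) : symmetric_op U ->
  symmetric_op (op_sqr U).
Proof.
by move=> symU x y [/= Ux UUx] [/= Uy UUy]; rewrite (symU _ _ UUx Uy) symU.
Qed.

Lemma sum_sqr_symmetric : symmetric_op H.
Proof.
move=> x y [Sx Tx] [Sy Ty]; rewrite [op_add _ _ x]/= [op_add _ _ y]/=.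
rewrite innerDl innerD.
by rewrite (op_sqr_symmetric symS Sx Sy) (op_sqr_symmetric symT Tx Ty).
Qed.

Lemma sum_sqrE x : dom (op_sqr D) x -> H x = op_sqr D x - A x.
Proof.
move=> Dx; have [[Sx Tx TSx STx] [_ /= SSx] [_ /= TTx]] := sum_sqr_dom Dx.
by rewrite /= !appD// /anticomm; lmod_coefs R[i]; ring.
Qed.

(* (D + z)(D - z) = D^2 - z^2 with z = t (1 - i b), and - z^2 = 2 i b t^2. *)
Lemma sum_sqr_surj (b : R) : b ^+ 2 = 1 -> exists2 t : R, 1 <= t &
  forall y, exists2 x, dom (op_sqr D) x &
    H x + (0 +i* (2 * b * t ^+ 2)) *: x = y.
Proof.
move=> bb; have [saD regD] := sum_self_adjoint.
have b1 : `|b| = 1.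
  by apply/eqP; rewrite -(@eqrXn2 _ 2)// real_normK ?num_real// bb expr1n.
pose K := c * (1 + elliptic_const); have K0 : 0 <= K.
  by rewrite mulr_ge0// addr_ge0// elliptic_const_ge0.
(* For w = (D - z) x one has |x| <= |w| and |D x| <= 2 |w|, so |[S,T] x| <= 3 K |w|, while t |w| <=
   |(D^2 - z^2) x|. The choice of t makes the quotient at most 1/2. *)
pose t := 1 + 6 * K; have t1 : 1 <= t by rewrite /t; lra.
have t0 : 0 < t := lt_le_trans ltr01 t1.
exists t => // y; pose z : R[i] := t +i* (- (b * t)).
have Imz : complex.Im z != 0.
  by rewrite /= oppr_eq0 -normr_eq0 normrM b1 mul1r normr_eq0 gt_eqF.
have ImzN : complex.Im (- z) != 0 by rewrite /= opprK -oppr_eq0.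
have zz : z * z = - (0 +i* (2 * b * t ^+ 2)).
  apply/eqP; rewrite eq_complex/= mulrNN; apply/andP; split; apply/eqP.
    by rewrite oppr0; have := bb; rewrite expr2 => bb'; ring: bb'.
  by ring.
have bound x : dom (op_sqr D) x ->
    nm (A x) <= 2^-1 * nm (op_sqr D x - (z * z) *: x).
  move=> Dx; have [Fx _ _] := sum_sqr_dom Dx.
  have [[Sx Tx] Wf] := Dx; have symD := sum_symmetric.
  pose f := D x; rewrite -[op_add S T x]/f in Wf.
  have Wx : dom D x by [].
  pose w := f - z *: x; have Ww : dom D w by apply/(domB Wf)/domZ.
  have wE : D x + (- z) *: x = w by rewrite /w scaleNr.
  have wE' : D w + z *: w = op_sqr D x - (z * z) *: x.
    have -> : D w = D f - z *: f by rewrite /w appB ?appZ//; exact: domZ.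
    by rewrite /w -[op_sqr D x]/(D f); lmod_coefs R[i]; ring.
  rewrite -wE'; have [_ le1] := shift_bound z symD Ww.
  have [le2 le3] := shift_bound (- z) symD Wx.
  have nz : `|complex.Im z| = t.
    by rewrite /= normrN normrM b1 mul1r ger0_norm// ltW.
  have nzN : `|complex.Im (- z)| = t.
    by rewrite /= opprK normrM b1 mul1r ger0_norm// ltW.
  rewrite nz in le1; rewrite nzN wE in le3; rewrite wE in le2.
  have Dle : nm f <= nm w + t * nm x.
    have -> : f = f + (complex.Re (- z))%:C *: x - (complex.Re (- z))%:C *: x.
      by rewrite addrK.
    apply: le_trans (nmB _ _) _; apply: lerD => //.
    by rewrite nmZ nmR /= normrN ger0_norm// ltW.
  have ell : nm (S x) + nm (T x) <= elliptic_const * (nm x + nm f).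
    have := @elliptic 1 x; rewrite mulr1 conjC1 /nm normr1 -/(nm x) scale1r.
    by apply.
  have Ax := bound_A Fx.
  have x0 := nm_ge0 x; have f0 := nm_ge0 f; have w0 := nm_ge0 w.
  have AK : nm (A x) <= K * (nm x + nm f).
    apply: le_trans Ax _; rewrite /K -mulrA ler_wpM2l//.
    by move: ell; lra.
  set r := nm (D w + z *: w) in le1 *.
  have xw : nm x <= nm w.
    by apply: le_trans le3; rewrite ler_peMl.
  have : K * (nm x + nm f) <= K * (3 * nm w) by rewrite ler_wpM2l//; lra.
  have : (1 + 6 * K) * nm w <= r by exact: le1.
  move: AK; lra.
have /choice[Q QP] : forall v, exists x, dom (op_sqr D) x /\
    op_sqr D x - (z * z) *: x = v.
  move=> v; have surjD := (self_adjoint_nonreal_surj saD regD).2.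
  have [w Ww wE] := surjD _ Imz v.
  have [x Wx xE] := surjD _ ImzN w.
  have DxE : D x = w + z *: x by rewrite -xE scaleNr subrK.
  have WDx : dom D (D x) by rewrite DxE; apply/domD/domZ.
  exists x; split; first by split.
  rewrite -[op_sqr D x]/(D (D x)) DxE appD ?appZ//; last exact: domZ.
  by rewrite DxE -wE; lmod_coefs R[i]; ring.
have q01 : 0 <= (2^-1 : R) < 1 by apply/andP; split; lra.
(* As H = D^2 - [S,T] on the domain of D^2, x = Q v solves (H - z^2) x = y exactly when v = y +
   [S,T] Q v. *)
have [|v vE] := @contraction_fixpoint _ _ (fun v => y + A (Q v)) _ q01.
  move=> v w; have [Dv vE] := QP v; have [Dw wE] := QP w.
  have [Fv _ _] := sum_sqr_dom Dv; have [Fw _ _] := sum_sqr_dom Dw.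
  rewrite opprD addrACA subrr add0r -anticommB//.
  have := bound _ (domB Dv Dw); rewrite appB//.
  have -> // : op_sqr D (Q v) - op_sqr D (Q w) - (z * z) *: (Q v - Q w) = v - w.
  transitivity ((op_sqr D (Q v) - (z * z) *: Q v) -
    (op_sqr D (Q w) - (z * z) *: Q w)); last by rewrite vE wE.
  by lmod_coefs R[i]; ring.
have [Dv QE] := QP v; exists (Q v) => //.
have yE : y = v - A (Q v) by rewrite -{1}vE addrK.
rewrite sum_sqrE// yE -[X in _ = X - _]QE zz.
by lmod_coefs R[i]; ring.
Qed.

Lemma sum_sqr_dom_eq : dom (op_sqr S) `&` dom (op_sqr T) = dom (op_sqr D).
Proof.
apply/seteqP; split=> [x Hx|x /sum_sqr_dom[] //].
have [t t1 surjH] := sum_sqr_surj (expr1n _ 2).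
have [x' Dx' xE] := surjH (H x + (0 +i* (2 * 1 * t ^+ 2)) *: x).
suff <- : x' = x by [].
apply: (shift_inj sum_sqr_symmetric _ _ _ xE) => //.
  rewrite -[complex.Im _]/(2 * 1 * t ^+ 2) mulr1 gt_eqF// mulr_gt0//.
  by rewrite exprn_gt0// (lt_le_trans ltr01).
by have [] := sum_sqr_dom Dx'.
Qed.

(** The resolvents of S + T map its domain into the domain of its square and tend to the
    identity. *)
Lemma sum_sqr_dense : dense (dom H).
Proof.
have [saD regD] := sum_self_adjoint.
have surjD := self_adjoint_nonreal_surj saD regD.
apply/denseP => x e e0; have e20 : 0 < e / 2 by rewrite divr_gt0.
have e40 : 0 < e / 4 by rewrite divr_gt0.
have /denseP/(_ x _ e20)[a Wa xa] := sum_dense.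
pose L n : R[i] := 0 +i* n.+1%:R.
have LP : diverging L := @diverging_imag R.
near \oo => n; have [iL _] := LP n.
have Wy := yos_dom surjD a iL.
exists (yos D (L n) a).
  rewrite -[dom H]/(dom (op_sqr S) `&` dom (op_sqr T)) sum_sqr_dom_eq.
  split=> //; rewrite -[op_add S T _]/(D _).
  by rewrite (op_yos surjD)//; apply/domZ/domB.
have := nm_sub_trans a x (yos D (L n) a).
have : nm (yos D (L n) a - a) <= e / 4.
  by near: n; exact: (yos_cvs surjD a sum_dense LP e40).
rewrite (nm_subC a); lra.
Unshelve. all: end_near. Qed.

Lemma sum_sqr_self_adjoint : self_adjoint H /\ regular H.
Proof.
have b1 : (-1) ^+ 2 = 1 :> R by rewrite sqrrN expr1n.
have [t t1 surj1] := sum_sqr_surj (expr1n _ 2).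
have [t' t1' surj2] := sum_sqr_surj b1.
have t0 : 0 < t := lt_le_trans ltr01 t1.
have t0' : 0 < t' := lt_le_trans ltr01 t1'.
have domH x : dom (op_sqr D) x -> dom H x by move=> /sum_sqr_dom[].
have s1 : surj_shift H (0 +i* (2 * 1 * t ^+ 2)).
  by move=> y; have [x /domH Hx xE] := surj1 y; exists x.
have s2 : surj_shift H (0 +i* (2 * -1 * t' ^+ 2)).
  by move=> y; have [x /domH Hx xE] := surj2 y; exists x.
have tpos := exprn_gt0 2 t0; have tpos' := exprn_gt0 2 t0'.
apply: (@symmetric_surj_self_adjoint _ _ _ _ (0 +i* 1)) => //.
- exact: sum_sqr_symmetric.
- exact: sum_sqr_dense.
- by rewrite /= oner_neq0.
- by apply: (surj_walk sum_sqr_symmetric s1); rewrite /=; nra.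
- by apply: (surj_walk sum_sqr_symmetric s2); rewrite /=; nra.
Qed.

End Sum.

Theorem theorem5p1 (R : realType) (B : cstarAlgType R) (E : hilbertModType B)
    (S T : operator E)
    (saS : self_adjoint S) (regS : regular S)
    (saT : self_adjoint T) (regT : regular T)
    (wac : weakly_anticommuting S T) :
  let H := op_add (op_sqr S) (op_sqr T) in
  [/\ dom H = dom (op_sqr S) `&` dom (op_sqr T),
      self_adjoint H,
      regular H,
      dom (op_sqr S) `&` dom (op_sqr T) = dom (op_sqr (op_add S T)) &
      dom (op_sqr S) `&` dom (op_sqr T) `<=` Fdom S T].
Proof.
move=> H; have surjS := self_adjoint_nonreal_surj saS regS.
have surjT := self_adjoint_nonreal_surj saT regT.
have clS := self_adjoint_closed saS; have clT := self_adjoint_closed saT.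
have [dS _] := saS; have [dT _] := saT.
have [c c1 bound_A] := wac_anticomm_bound wac.
have [_ [C [coreC [r r0 imC]]]] := wac.
(* Beyond l0 both the core condition and the absorption argument with |l| >= 2 c are available. *)
pose l0 := Num.max r (2 * c).
have l0c : 2 * c <= l0 by rewrite le_max lexx orbT.
have J_F l e : imaginary l -> l0 <= nm l -> dom T e -> Fdom S T (yos S l e).
  move=> il; rewrite ge_max => /andP[rl cl] Te.
  apply: (yos_Fdom surjS clS clT c1 bound_A il cl coreC _ Te).
  by apply: imC; [exact: imaginary_Re|rewrite nmE lecR].
have [saH regH] :=
  sum_sqr_self_adjoint surjS surjT clS clT dS dT c1 bound_A l0c J_F.
have domE := sum_sqr_dom_eq surjS surjT clS clT dS dT c1 bound_A l0c J_F.
split=> //.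
rewrite domE => x.
by move=> /(sum_sqr_dom surjS surjT clS clT dS c1 bound_A l0c J_F)[].
Qed.
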